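(* Let $f$ be the two-layer network below with scaling factor $b=\sqrt m$, let $\delta\in(0,1)$, $D>1$, and $R=D\sqrt d$. Let $x_1,\dots,x_T\in\mathbb{S}_p$ and let $\ell_1,\dots,\ell_T:\mathbb{R}^d\to\mathbb{R}$ be convex, differentiable and $L$-Lipschitz. Then with probability at least $1-\delta$ over the random initialization, Algorithm 1 with step sizes $\eta_t=\frac{2R}{CL}t^{-1/2}$ satisfies $$\sum_{t=1}^T\ell_t(f(\theta_t;x_t))\le\min_{g\in\mathcal F^d_{RF}(D)}\sum_{t=1}^T\ell_t(g(x_t))+\tilde O\Big(\frac{L\sqrt{dp}\,CD^2T}{\sqrt m}\Big)+O\Big(CLD\sqrt{dT}+\frac{CLD^2dT}{\sqrt m}\Big),$$ where $\tilde O$ hides factors polylogarithmic in $\delta$ and $d$.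
   Context: Let $p,d\ge1$, $m$ an even positive integer, $b>0$, $C>0$, and $\mathbb{S}_p=\{x\in\mathbb{R}^p:\|x\|_2=1\}$. Let $\sigma:\mathbb{R}\to\mathbb{R}$ be differentiable with $|\sigma'(z)-\sigma'(z')|\le C|z-z'|$ and $|\sigma'(z)|\le C$ for all $z,z'$. Parameters are $\theta=(\theta[1],\dots,\theta[d])\in\mathbb{R}^{d\times m\times p}$, where $\theta[i]\in\mathbb{R}^{m\times p}$ has rows $\theta[i,1]^\top,\dots,\theta[i,m/2]^\top,\bar\theta[i,1]^\top,\dots,\bar\theta[i,m/2]^\top$. The two-layer network is $f(\theta;x)=(f_1(\theta[1];x),\dots,f_d(\theta[d];x))^\top$ with $f_i(\theta[i];x)=\frac1b\big(\sum_{r=1}^{m/2}a_{i,r}\sigma(\theta[i,r]^\top x)+\sum_{r=1}^{m/2}\bar a_{i,r}\sigma(\bar\theta[i,r]^\top x)\big)$, where the $a_{i,r}$ are independent uniform signs in $\{\pm1\}$ and $\bar a_{i,r}=-a_{i,r}$, fixed. The random initialization $\theta_1$ has $\theta_1[i,r]\sim\mathcal N(0,I_p)$ i.i.d. for $r\le m/2$ and $\bar\theta_1[i,r]=\theta_1[i,r]$. $B(R)=\{\theta:\|\theta-\theta_1\|_F\le R\}$. Algorithm 1 (OGD for neural networks): start at $\theta_1$; at round $t$ play $\theta_t$, receive $x_t,\ell_t$, update $\theta_{t+1}=\Pi_{B(R)}(\theta_t-\eta_t\nabla_\theta\ell_t(f(\theta_t;x_t)))$ with $\Pi_{B(R)}$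 the Frobenius projection. Random feature space: for $c:\mathbb{R}^p\to\mathbb{R}^p$, consider $h(x)=\int_{\mathbb{R}^p}c(w)^\top x\,\sigma'(w^\top x)\,dw$ with RF-norm $\|h\|_{RF}=\sup_w\|c(w)\|_2/p_0(w)$, where $p_0$ is the density of $\mathcal N(0,I_p)$; $\mathcal F_{RF}(D)$ is the set of such $h$ with $\|h\|_{RF}\le D$, and $\mathcal F^d_{RF}(D)=\{h=(h_1,\dots,h_d):h_i\in\mathcal F_{RF}(D)\}$. *)

(* Defs.v *)
From HB Require Import structures.
From mathcomp Require Import all_boot all_order all_algebra.
From mathcomp Require Import all_classical all_reals all_analysis.
Set Implicit Arguments. Unset Strict Implicit. Unset Printing Implicit Defensive.
Import Order.TTheory GRing.Theory Num.Theory.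
Import numFieldNormedType.Exports.
Local Open Scope classical_set_scope.
Local Open Scope ring_scope.

Section Defs.
Variable R : realType.

(* Parameters theta in R^{d x m x p} with m = n + n (m even, n = m/2).
   Row r of theta[i] : rows 0..n-1 are theta[i,1..n], rows n..2n-1 are
   bar theta[i,1..n]  (split r = inl j / inr j). *)
Definition param (d n p : nat) := 'I_d -> 'I_(n + n) -> 'I_p -> R.

Definition sgn (b : bool) : R := if b then 1 else -1.

Definition coef d n (a : 'I_d -> 'I_n -> bool) (i : 'I_d) (r : 'I_(n + n)) : R :=
  match fintype.split r with inl j => sgn (a i j) | inr j => - sgn (a i j) end.

Definition net d n p (sigma : R -> R) (a : 'I_d -> 'I_n -> bool)
    (theta : param d n p) (x : 'I_p -> R) : 'rV[R]_d :=
  \row_i ((Num.sqrt (n + n)%:R)^-1 *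
     \sum_(r < n + n) coef a i r * sigma (\sum_(k < p) theta i r k * x k)).

Definition init d n p (W : 'I_d -> 'I_n -> 'I_p -> R) : param d n p :=
  fun i r k => match fintype.split r with inl j => W i j k | inr j => W i j k end.

Definition frob_dist d n p (th th' : param d n p) : R :=
  Num.sqrt (\sum_(i < d) \sum_(r < n + n) \sum_(k < p) (th i r k - th' i r k) ^+ 2).

Definition proj_ball d n p (c : param d n p) (Rad : R) (th : param d n p) : param d n p :=
  let dist := frob_dist th c in
  if dist <= Rad then th
  else fun i r k => c i r k + Rad / dist * (th i r k - c i r k).

Definition grad d n p (F : param d n p -> R) (th : param d n p) : param d n p :=
  fun i r k => derive1 (fun h : R => F (fun i' r' k' =>
     th i' r' k' + (if [&& i' == i, r' == r & k' == k] then h else 0))) 0.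

(* Algorithm 1 (OGD).  traj k = theta_{k+1}; at round t the learner plays
   theta_t = traj t.-1 and updates with step size eta t, point x t, loss l t. *)
Fixpoint traj d n p (sigma : R -> R) (a : 'I_d -> 'I_n -> bool)
    (W : 'I_d -> 'I_n -> 'I_p -> R) (Rad : R) (eta : nat -> R)
    (x : nat -> 'I_p -> R) (l : nat -> 'rV[R]_d -> R) (k : nat) : param d n p :=
  match k with
  | 0 => init W
  | k'.+1 =>
      let th := traj sigma a W Rad eta x l k' in
      let g := grad (fun th' => l k'.+1 (net sigma a th' (x k'.+1))) th in
      proj_ball (init W) Rad (fun i r q => th i r q - eta k'.+1 * g i r q)
  end.

Fixpoint iint (k : nat) (g : seq R -> R) : R :=
  match k with
  | 0 => g [::]
  | k'.+1 => Rintegral (@lebesgue_measure R) setT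
               (fun y : R => iint k' (fun s => g (y :: s)))
  end.

Definition integral_Rp (p : nat) (G : p.-tuple R -> R) : R :=
  iint p (fun s => G (insubd (nseq_tuple p (0 : R)) s)).

Definition gauss_density (p : nat) (w : p.-tuple R) : R :=
  (Num.sqrt (pi *+ 2)) ^- p * expR (- (\sum_(k < p) tnth w k ^+ 2) / 2).

Definition rf_fun (p : nat) (sigma : R -> R) (c : p.-tuple R -> 'I_p -> R)
    (x : 'I_p -> R) : R :=
  integral_Rp (fun w => (\sum_(k < p) c w k * x k) *
                        derive1 sigma (\sum_(k < p) tnth w k * x k)).

(* c is (Borel) measurable and ||h||_RF = sup_w ||c(w)||_2 / p_0(w) <= D *)
Definition rf_coef_in (p : nat) (D : R) (c : p.-tuple R -> 'I_p -> R) : Prop :=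
  (forall k : 'I_p, measurable_fun setT (fun w : p.-tuple R => c w k)) /\
  (forall w, Num.sqrt (\sum_(k < p) c w k ^+ 2) / gauss_density w <= D).

Definition eucl_norm d (u : 'rV[R]_d) : R := Num.sqrt (\sum_(i < d) u 0 i ^+ 2).

End Defs.

(* Main.v *)
Require Import Defs.
From HB Require Import structures.
From mathcomp Require Import all_boot all_order all_algebra.
From mathcomp Require Import all_classical all_reals all_analysis.
From mathcomp Require Import measurable_realfun ring lra.
Import Order.TTheory GRing.Theory Num.Theory.
Import numFieldNormedType.Exports.
Local Open Scope classical_set_scope.
Local Open Scope ring_scope.


(** Online gradient descent on the linearized losses has regret
    [3 C L Rad sqrt T] against every point [U] of the ball: the Jacobian of the
    network is block diagonal with blocks of norm at most [C], and replacing
    the network by its linearization at [theta_t] costs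
    [C |U - theta_t|^2 / sqrt m].  For a comparator [g] with coefficients [c]
    take for [U] the initialization moved by [a_{i,r} c_i(w_r) / (sqrt m p_0(w_r))].
    As the symmetric initialization makes the network vanish at [theta_1], the
    network at [U] is, up to [C D^2 / sqrt m] per output, the empirical mean over
    the [w_r] of [(c_i(w)/p_0(w))^T x sigma'(w^T x)], whose expectation is [g_i(x)].
    For each output [i] the centered sum [u_{t,i}] over [r], suitably normalized,
    satisfies [E(e^u + e^-u) <= 4], so one application of Markov's inequality to the
    sum over all [t] and [i] bounds the mean square of the [u_{t,i}] by a multiple
    of [(1 + ln (1/delta))^2], without any union bound.  Since the data are
    fixed in advance, it suffices to compete with one near-minimizer [g]. *)

Set Implicit Arguments. Unset Strict Implicit. Unset Printing Implicit Defensive.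

(** * Products of a probability measure *)

Section product_probability.
Context (R : realType) (d : measure_display) (T : measurableType d).

Definition boxes (G : set (set T)) n : set (set (n.-tuple T)) :=
  [set A | exists B : 'I_n -> set T,
     (forall k, G (B k)) /\ A = [set t | forall k, B k (tnth t k)]].

Lemma measurable_box n (B : 'I_n -> set T) : (forall k, measurable (B k)) ->
  measurable [set t : n.-tuple T | forall k, B k (tnth t k)].
Proof.
move=> mB.
have -> : [set t : n.-tuple T | forall k, B k (tnth t k)] =
    \big[setI/setT]_(k < n) ((fun t : n.-tuple T => tnth t k) @^-1` B k).
  apply/seteqP; split => t /=.
    by move=> Bt; apply: (big_ind (fun X : set (n.-tuple T) => X t)) => // k _; exact: Bt.
  by move=> tB k; move: tB; rewrite (bigD1 k)//= => -[].
elim/big_ind : _ => //; first exact: measurableI.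
by move=> k _; rewrite -[X in measurable X]setTI; exact: measurable_tnth.
Qed.

Lemma setI_closed_boxes (G : set (set T)) n :
  setI_closed G -> setI_closed (boxes G (n := n)).
Proof.
move=> GI A B [A' [GA ->]] [B' [GB ->]].
exists (fun k => A' k `&` B' k); split=> [k|]; first exact: GI.
by apply/seteqP; split=> [t [At Bt] k|t ABt]; split => // k; case: (ABt k).
Qed.

(** Since [setT] belongs to [G], a condition on one coordinate is itself a box with all other sides
    full, so boxes already generate every projection. *)
Lemma measurable_boxes (G : set (set T)) n :
  measurable = <<s G >> -> G setT ->
  measurable = <<s boxes G (n := n) >>.
Proof.
move=> mG GT; apply/seteqP; split.
  apply: smallest_sub; first exact: smallest_sigma_algebra.
  elim/big_ind : _ => [//|X Y XG YG A|i _].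
    by case=> [/XG|/YG].
  move=> _ [A mA <-]; rewrite setTI.
  (* The sets whose preimage under the [i]-th projection is generated by boxes form a sigma-algebra,
     so only members of [G] have to be checked. *)
  suff : measurable `<=` image_set_system setT (fun t : n.-tuple T => tnth t i)
      <<s boxes G (n := n) >> by move/(_ _ mA); rewrite /image_set_system /= setTI.
  rewrite mG; apply: smallest_sub.
    exact/sigma_algebra_image/smallest_sigma_algebra.
  move=> B GB; rewrite /image_set_system /= setTI; apply: sub_sigma_algebra.
  exists (fun k => if k == i then B else setT); split.
    by move=> k; case: ifP.
  apply/seteqP; split=> [t Bt k|t /(_ i)]; last by rewrite eqxx.
  by case: eqP => // ->.
apply: smallest_sub; first exact: sigma_algebra_measurable.
move=> _ [B [GB ->]]; apply: measurable_box => k.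
by rewrite mG; exact: sub_sigma_algebra.
Qed.

Definition tcons n (z : T * n.-tuple T) : n.+1.-tuple T :=
  [tuple of z.1 :: z.2].

Lemma measurable_tcons n : measurable_fun setT (@tcons n).
Proof. by apply: measurable_cons; [exact: measurable_fst|exact: measurable_snd]. Qed.

HB.instance Definition _ n :=
  isMeasurableFun.Build _ _ _ _ (@tcons n) (@measurable_tcons n).

(** The recursion along [tcons] lets Fubini and Tonelli remove one coordinate at a time; the same
    construction serves for [p] Gaussian entries and for [n] vectors of such entries. *)
Fixpoint iid_law (Q : probability T R) n : probability (n.-tuple T) R :=
  match n return probability (n.-tuple T) R with
  | 0 => \d_([tuple] : 0.-tuple T)
  | n'.+1 => distribution (Q \x iid_law Q n')%E (@tcons n')
  end.

Lemma iid_law_box (Q : probability T R) n (B : 'I_n -> set T) :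
  (forall k, measurable (B k)) ->
  iid_law Q n [set t | forall k, B k (tnth t k)]
    = (\prod_(k < n) fine (Q (B k)))%:E.
Proof.
elim: n B => [|n IH] B mB.
  by rewrite big_ord0 /= diracE mem_set// => -[].
rewrite big_ord_recl /= /distribution /pushforward.
rewrite [X in (_ \x _)%E X](_ : _ = B ord0 `*`
    [set t | forall k, B (lift ord0 k) (tnth t k)]); last first.
  apply/seteqP; split=> [[y t] /= Bt|[y t] /= [By Bt] k].
    split=> [|k]; first by have := Bt ord0; rewrite tnth0.
    by have := Bt (lift ord0 k); rewrite tnthS.
  case: (unliftP ord0 k) => [j ->|->]; first by rewrite tnthS.
  by rewrite tnth0.
rewrite product_measure1E//; last exact: (@measurable_box n (fun k => B (lift ord0 k))).
rewrite EFinM fineK ?fin_num_measure//; congr (_ * _)%E.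
exact: (IH (fun k => B (lift ord0 k))).
Qed.

(** Boxes form a pi-system generating the tuple sigma-algebra. The sides range over a generating [G]
    only, because for vectors of vectors the law is known just on boxes of boxes. *)
Lemma iid_law_unique (Q : probability T R) (G : set (set T)) n
    (m : {measure set (n.-tuple T) -> \bar R}) :
  measurable = <<s G >> -> G setT -> setI_closed G ->
  (forall B : 'I_n -> set T, (forall k, G (B k)) ->
     m [set t | forall k, B k (tnth t k)] = (\prod_(k < n) fine (Q (B k)))%:E) ->
  forall A, measurable A -> m A = iid_law Q n A.
Proof.
move=> mG GT GI mE.
have mB (B : set T) : G B -> measurable B.
  by rewrite mG; exact: sub_sigma_algebra.
have mbox A : boxes G A -> m A = iid_law Q n A.
  by move=> [B [GB ->]]; rewrite mE// iid_law_box// => k; exact: mB.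
have bT : boxes G (n := n) setT.
  by exists (fun=> setT); split => //; apply/seteqP; split.
move=> A mA; apply: (@measure_unique _ R _ (boxes G (n := n)) (fun=> setT)) => //.
- exact: measurable_boxes.
- exact: setI_closed_boxes.
- by rewrite bigcup_const.
- by move=> k; rewrite mbox// probability_setT ltry.
Qed.

(** Tonelli splits off the first factor. This is the form in which independence enters the moment
    generating function. *)
Lemma ge0_integral_iid_law_prod (Q : probability T R) (F : T -> R) n :
  measurable_fun setT F -> (forall y, 0 <= F y) ->
  (\int[iid_law Q n]_t (\prod_(k < n) F (tnth t k))%:E =
     \prod_(k < n) \int[Q]_y (F y)%:E)%E.
Proof.
move=> mF F0; elim: n => [|n IH] /=.
  rewrite big_ord0 integral_dirac// ?diracT ?mul1e ?big_ord0//.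
  rewrite (_ : (fun _ => _) = cst 1%:E)//.
  by apply/funext => t; rewrite big_ord0.
have mP k : measurable_fun setT (fun t : k.-tuple T => \prod_(j < k) F (tnth t j)).
  apply: measurable_prod => j _.
  exact: (measurableT_comp mF (measurable_tnth j)).
rewrite ge0_integral_distribution/=; last 2 first.
- by apply/measurable_EFinP; exact: mP.
- by move=> t; rewrite lee_fin prodr_ge0.
rewrite fubini_tonelli1/=; last 2 first.
- apply/measurable_EFinP.
  exact: (measurableT_comp (mP n.+1) (@measurable_tcons n)).
- by move=> t; rewrite lee_fin prodr_ge0.
rewrite big_ord_recl -ge0_integralZr//; last 3 first.
- by apply/measurable_EFinP; exact: mF.
- by move=> y _; rewrite lee_fin.
- by apply: prode_ge0 => k _; apply: integral_ge0 => y _; rewrite lee_fin.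
apply: eq_integral => y _; rewrite /fubini_F -IH.
rewrite -ge0_integralZl//; last 3 first.
- by apply/measurable_EFinP; exact: mP.
- by move=> t _; rewrite lee_fin prodr_ge0.
- by rewrite lee_fin.
apply: eq_integral => t _; rewrite big_ord_recl -EFinM tnth0; congr (_ * _)%:E.
by apply: eq_bigr => k _; rewrite tnthS.
Qed.

End product_probability.

(** * Gaussian integrals *)

Section gaussian.
Context (R : realType).

Notation N01 := (normal_prob (0 : R) 1).

Lemma normal_pdf01 (y : R) :
  normal_pdf 0 1 y = (Num.sqrt (pi *+ 2))^-1 * expR (- y ^+ 2 / 2).
Proof.
rewrite /normal_pdf (negbTE (oner_neq0 _)) /normal_peak /normal_fun.
by rewrite expr1n mul1r subr0.
Qed.

Lemma bounded_integrable d (T : measurableType d) (P : probability T R)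
    (f : T -> R) (B : R) :
  measurable_fun setT f -> (forall y, `|f y| <= B) ->
  P.-integrable setT (EFin \o f).
Proof.
move=> mf fB; apply: measurable_bounded_integrable => //.
  exact: (le_lt_trans (probability_le1 P measurableT) (ltry 1)).
exists B; split; first exact: num_real.
by move=> M BM y _; exact: le_trans (fB y) (ltW BM).
Qed.

(** The Radon-Nikodym derivative of the normal law is determined almost everywhere only; it agrees
    with [normal_pdf] because both have the same integral over every measurable set. *)
Lemma integral_normal_prob (f : R -> \bar R) :
  (N01).-integrable setT f ->
  (\int[N01]_y f y = \int[lebesgue_measure]_y (f y * (normal_pdf 0 1 y)%:E))%E.
Proof.
move=> intf.
have dom := @normal_prob_dominates R 0 1.
have mf : measurable_fun setT f by exact: measurable_int intf.
rewrite -(Radon_Nikodym_change_of_variables dom)//=.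
apply: ae_eq_integral => //.
- by apply: emeasurable_funM.
- apply: emeasurable_funM => //=; apply/measurableT_comp => //=.
  exact: measurable_normal_pdf.
- apply: ae_eqe_mul2l => /=.
  rewrite Radon_NikodymE//=.
  case: cid => /= h [h1 h2 h3].
  apply: integral_ae_eq => //=.
  + by apply/measurableT_comp => //; exact: measurable_normal_pdf.
  + by move=> E E01 mE; rewrite -h3.
Qed.

Lemma Rintegral_normal_prob (f : R -> R) (B : R) :
  measurable_fun setT f -> (forall y, `|f y| <= B) ->
  Rintegral N01 setT f =
   Rintegral (@lebesgue_measure R) setT (fun y => normal_pdf 0 1 y * f y).
Proof.
move=> mf fB; rewrite /Rintegral integral_normal_prob.
  by congr fine; apply: eq_integral => y _; rewrite -EFinM mulrC.
exact: (bounded_integrable N01 mf fB).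
Qed.

Lemma normr_Rintegral_le d (T : measurableType d) (P : probability T R)
    (f : T -> R) (B : R) :
  measurable_fun setT f -> (forall y, `|f y| <= B) ->
  `|Rintegral P setT f| <= B.
Proof.
move=> mf fB.
have intf := bounded_integrable P mf fB.
apply: (le_trans (le_normr_Rintegral measurableT intf)).
have B0 : 0 <= B by exact: le_trans (normr_ge0 _) (fB point).
have -> : B = Rintegral P setT (fun=> B).
  by rewrite Rintegral_cst// [fine _](congr1 fine (probability_setT P)) mulr1.
apply: le_Rintegral => //; first exact: integrable_norm.
by apply: (@bounded_integrable _ _ P (fun=> B) B) => // y; rewrite ger0_norm.
Qed.

(** Fubini for bounded functions; the bound makes each inner integral finite, so that taking [fine]
    inside loses nothing. *)
Lemma Rintegral_iid_lawS d (T : measurableType d) (Q : probability T R) n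
    (F : n.+1.-tuple T -> R) (B : R) :
  measurable_fun setT F -> (forall t, `|F t| <= B) ->
  Rintegral (iid_law Q n.+1) setT F =
  Rintegral Q setT (fun y => Rintegral (iid_law Q n) setT
    (fun t => F [tuple of y :: t])).
Proof.
move=> mF FB.
have mFc : measurable_fun setT (F \o @tcons _ T n).
  exact: measurableT_comp mF (@measurable_tcons _ T n).
have FcB t : `|(F \o @tcons _ T n) t| <= B by exact: FB.
have intF : (Q \x iid_law Q n)%E.-integrable setT (EFin \o (F \o @tcons _ T n)).
  exact: (bounded_integrable (Q \x iid_law Q n)%E mFc FcB).
rewrite /Rintegral /= integral_distribution//; last first.
  by apply/measurable_EFinP.
rewrite -[X in fine X](integral12_prod_meas1 intF); congr fine.
apply: eq_integral => y _; rewrite /fubini_F fineK//.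
apply: integrable_fin_num => //.
apply: (@bounded_integrable _ _ (iid_law Q n) (fun t => F [tuple of y :: t]) B) => //.
exact: (measurableT_comp mFc (measurable_pair1 y)).
Qed.

Lemma measurable_Rintegral_iid_law d (T : measurableType d) (Q : probability T R) n
    (F : n.+1.-tuple T -> R) (B : R) :
  measurable_fun setT F -> (forall t, `|F t| <= B) ->
  measurable_fun setT (fun y => Rintegral (iid_law Q n) setT
    (fun t => F [tuple of y :: t])).
Proof.
move=> mF FB.
have mFc : measurable_fun setT (F \o @tcons _ T n).
  exact: measurableT_comp mF (@measurable_tcons _ T n).
have FcB t : `|(F \o @tcons _ T n) t| <= B by exact: FB.
have intF : (Q \x iid_law Q n)%E.-integrable setT (EFin \o (F \o @tcons _ T n)).
  exact: (bounded_integrable (Q \x iid_law Q n)%E mFc FcB).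
have := measurable_fubini_F intF.
by move=> /(measurableT_comp (@fine_measurable _ setT measurableT)).
Qed.

End gaussian.

(** * Gaussian expectations as iterated Lebesgue integrals *)

Section gaussian_density.
Context (R : realType).
Notation N01 := (normal_prob (0 : R) 1).

Lemma eq_iint p (g1 g2 : seq R -> R) :
  (forall s, size s = p -> g1 s = g2 s) -> iint p g1 = iint p g2.
Proof.
elim: p g1 g2 => [|p IH] g1 g2 g12 /=; first exact: g12.
apply: eq_Rintegral => y _; apply: IH => s sp.
by apply: g12; rewrite /= sp.
Qed.

(** The density is a product of one-dimensional normal densities. Each induction step turns one
    Lebesgue integral into a normal expectation. *)
Lemma iint_gauss p (g : seq R -> R) (B : R) :
  measurable_fun setT (fun t : p.-tuple R => g t) ->
  (forall s, `|g s| <= B) ->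
  iint p (fun s => (Num.sqrt (pi *+ 2)) ^- p *
     expR (- (\sum_(k < p) (nth 0 s k) ^+ 2) / 2) * g s) =
  Rintegral (iid_law N01 p) setT (fun t => g t).
Proof.
elim: p g B => [|p IH] g B mg gB.
  rewrite /= expr0 invr1 mul1r big_ord0 oppr0 mul0r expR0 mul1r.
  rewrite /Rintegral integral_dirac//; last exact/measurable_EFinP.
  by rewrite diracT mul1e.
have mpdf := measurable_normal_pdf (0 : R) 1.
have mgy y : measurable_fun setT (fun t : p.-tuple R => g (y :: t)).
  exact: (measurableT_comp (measurableT_comp mg (@measurable_tcons _ _ p))
    (measurable_pair1 y)).
have gB' (t : p.+1.-tuple R) : `|g t| <= B by exact: gB.
apply: etrans; last exact/esym/(Rintegral_iid_lawS N01 mg gB').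
rewrite (@Rintegral_normal_prob _ _ B); last 2 first.
- exact: (@measurable_Rintegral_iid_law _ _ _ N01 p (fun t : p.+1.-tuple R => g t) B).
- move=> y.
  exact: (@normr_Rintegral_le R _ _ (iid_law N01 p) _ B (mgy y) (fun=> gB _)).
rewrite [LHS]/=; apply: eq_Rintegral => y _.
rewrite -RintegralZl//; last first.
  exact: (bounded_integrable (iid_law N01 p) (mgy y) (fun=> gB _)).
(* For fixed [y] the factor [normal_pdf 0 1 y] is absorbed into the integrand, which stays
   bounded. *)
rewrite -(IH (fun s => normal_pdf 0 1 y * g (y :: s)) (`|normal_pdf 0 1 y| * B)).
- congr iint; apply/funext => s.
  rewrite big_ord_recl /= normal_pdf01 exprS invfM opprD mulrDl expRD.
  by ring.
- exact: measurable_funM.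
- by move=> s; rewrite normrM ler_wpM2l.
Qed.

Lemma integral_Rp_gauss p (rho : p.-tuple R -> R) (B : R) :
  measurable_fun setT rho -> (forall t, `|rho t| <= B) ->
  integral_Rp (fun w => gauss_density w * rho w) =
  Rintegral (iid_law N01 p) setT rho.
Proof.
move=> mrho rhoB.
have insubdE (t : p.-tuple R) : insubd (nseq_tuple p 0) (t : seq R) = t.
  by rewrite -[X in insubd _ X]/(val t) valKd.
transitivity (Rintegral (iid_law N01 p) setT
    (fun t => (fun s => rho (insubd (nseq_tuple p 0) s)) (t : p.-tuple R))).
  have mg : measurable_fun setT
      (fun t : p.-tuple R => rho (insubd (nseq_tuple p 0) (t : seq R))).
    by rewrite (_ : (fun _ => _) = rho)//; apply/funext => t; rewrite insubdE.
  have <- := @iint_gauss p (fun s => rho (insubd (nseq_tuple p 0) s)) B mg (fun=> rhoB _).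
  apply: eq_iint => s /eqP sp; pose t := Tuple sp.
  rewrite -[s]/(val t) insubdE /gauss_density; congr (_ * expR (- _ / 2) * _).
  by apply: eq_bigr => k _; rewrite (tnth_nth 0).
by apply: eq_Rintegral => t _; rewrite insubdE.
Qed.

End gaussian_density.

(** * Projected gradient descent *)

Section cauchy_schwarz.
Context (R : realType).

(** Cauchy-Schwarz, from the nonnegative quadratic form [q]: taken at [(vv, uv)] it yields
    [vv * (uu * vv - uv ^+ 2) >= 0], and when [vv = 0] its value at [(uv, uu + 1)] forces
    [uv = 0]. *)
Lemma sum_mul_sqr_le (I : finType) (u v : I -> R) :
  (\sum_i u i * v i) ^+ 2 <= (\sum_i u i ^+ 2) * (\sum_i v i ^+ 2).
Proof.
set uu := \sum_i u i ^+ 2; set vv := \sum_i v i ^+ 2; set uv := \sum_i u i * v i.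
have vv0 : 0 <= vv by apply: sumr_ge0 => i _; exact: sqr_ge0.
have q (s t : R) : 0 <= s ^+ 2 * uu - 2 * s * t * uv + t ^+ 2 * vv.
  have -> : s ^+ 2 * uu - 2 * s * t * uv + t ^+ 2 * vv =
      \sum_i (s * u i - t * v i) ^+ 2.
    rewrite /uu /vv /uv !mulr_sumr -sumrB -big_split /=.
    by apply: eq_bigr => i _; ring.
  by apply: sumr_ge0 => i _; exact: sqr_ge0.
have [vv_eq0|vv_neq0] := eqVneq vv 0.
  have uu0 : 0 <= uu by apply: sumr_ge0 => i _; exact: sqr_ge0.
  have := q uv (uu + 1); rewrite vv_eq0 !mulr0 addr0 => H.
  have : 0 <= uv ^+ 2 by exact: sqr_ge0.
  by nra.
have vv_gt0 : 0 < vv by rewrite lt_neqAle eq_sym vv_neq0.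
have := q vv uv => H.
have : 0 <= vv * (uu * vv - uv ^+ 2) by nra.
by rewrite pmulr_rge0// subr_ge0.
Qed.

Lemma sum_mul_le (I : finType) (u v : I -> R) (a b : R) :
  0 <= a -> 0 <= b ->
  \sum_i u i ^+ 2 <= a ^+ 2 -> \sum_i v i ^+ 2 <= b ^+ 2 ->
  \sum_i u i * v i <= a * b.
Proof.
move=> a0 b0 ua vb.
apply: le_trans (ler_norm _) _.
rewrite -(@ler_pXn2r _ 2)// ?nnegrE ?mulr_ge0// real_normK ?num_real//.
rewrite exprMn; apply: (le_trans (sum_mul_sqr_le u v)).
by apply: ler_pM => //; apply: sumr_ge0 => i _; exact: sqr_ge0.
Qed.

End cauchy_schwarz.

Section online_gradient_descent.
Context (R : realType) (I : finType).
Implicit Types u v c : I -> R.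

Definition sqdist u v : R := \sum_i (u i - v i) ^+ 2.

Lemma sqdist_ge0 u v : 0 <= sqdist u v.
Proof. by apply: sumr_ge0 => i _; exact: sqr_ge0. Qed.

(** A version of [proj_ball] over an arbitrary finite index type, so that the descent analysis
    ignores the three-index shape of the parameters. *)
Definition ball_proj c (r : R) v : I -> R :=
  if Num.sqrt (sqdist v c) <= r then v
  else fun i => c i + r / Num.sqrt (sqdist v c) * (v i - c i).

Lemma sqdist_ball_proj_center c r v : 0 <= r -> sqdist (ball_proj c r v) c <= r ^+ 2.
Proof.
move=> r0; rewrite /ball_proj; case: ifPn => [vr|].
  rewrite -[leLHS]sqr_sqrtr ?sqdist_ge0//.
  by rewrite ler_pXn2r// nnegrE sqrtr_ge0.
rewrite -ltNge => rv; set s := Num.sqrt _ in rv *.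
have s0 : 0 < s by exact: le_lt_trans rv.
rewrite /sqdist (eq_bigr (fun i => (r / s) ^+ 2 * (v i - c i) ^+ 2)); last first.
  by move=> i _; rewrite addrAC subrr add0r exprMn.
rewrite -mulr_sumr -/(sqdist v c) -[sqdist v c]sqr_sqrtr ?sqdist_ge0// -/s.
by rewrite -exprMn divfK// gt_eqF.
Qed.

(** With [a = r / s < 1], the decrease of the squared distance factors as
    [(1 - a) * ((1 + a) * s ^+ 2 - 2 * uv)]. It is nonnegative because Cauchy-Schwarz bounds [uv] by
    [s * r = a * s ^+ 2]. *)
Lemma sqdist_ball_proj c r v u : 0 <= r -> sqdist u c <= r ^+ 2 ->
  sqdist (ball_proj c r v) u <= sqdist v u.
Proof.
move=> r0 ucr; rewrite /ball_proj; case: ifPn => //.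
rewrite -ltNge; set s := Num.sqrt _ => rs.
have s0 : 0 < s by exact: le_lt_trans rs.
have ss : s ^+ 2 = sqdist v c by rewrite sqr_sqrtr ?sqdist_ge0.
set a := r / s.
have ra : r = a * s by rewrite /a divfK// gt_eqF.
have a1 : a < 1 by rewrite /a ltr_pdivrMr// mul1r.
have a0 : 0 <= a by rewrite divr_ge0// ltW.
pose uv := \sum_i (v i - c i) * (u i - c i).
have uvle : uv <= s * r by apply: sum_mul_le; [exact: ltW|by []|rewrite ss|].
have E (t : R) : \sum_i (c i + t * (v i - c i) - u i) ^+ 2 =
    t ^+ 2 * s ^+ 2 - 2 * t * uv + sqdist u c.
  rewrite ss /sqdist /uv !mulr_sumr -sumrB -big_split /=.
  by apply: eq_bigr => i _; ring.
rewrite /sqdist E.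
have -> : \sum_i (v i - u i) ^+ 2 = \sum_i (c i + 1 * (v i - c i) - u i) ^+ 2.
  by apply: eq_bigr => i _; rewrite mul1r [c i + _]addrC subrK.
rewrite E -subr_ge0.
have -> : 1 ^+ 2 * s ^+ 2 - 2 * 1 * uv + sqdist u c -
    (a ^+ 2 * s ^+ 2 - 2 * a * uv + sqdist u c) =
  (1 - a) * ((1 + a) * s ^+ 2 - 2 * uv) by ring.
rewrite mulr_ge0 ?subr_ge0 ?(ltW a1)//.
apply: (@le_trans _ _ (2 * (s * r))); first by rewrite ler_pM2l.
have := sqr_ge0 s; rewrite ra => ?; nra.
Qed.

Lemma sqdist_ball u v c (r : R) : 0 <= r ->
  sqdist u c <= r ^+ 2 -> sqdist v c <= r ^+ 2 -> sqdist u v <= 4 * r ^+ 2.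
Proof.
move=> r0 uc vc.
have : sqdist u v <= 2 * sqdist u c + 2 * sqdist v c; last by lra.
rewrite /sqdist !mulr_sumr -big_split /=; apply: ler_sum => i _.
have := sqr_ge0 (u i - c i + (v i - c i)); nra.
Qed.

(** Telescoping bound behind [sum 1 / sqrt t <= 2 sqrt T]; with [p ^+ 2 = q ^+ 2 + 1] it amounts to
    [(p - q) ^+ 2 >= 0]. *)
Lemma inv_sqrt_le (k : nat) :
  (Num.sqrt k.+1%:R)^-1 <= 2 * (Num.sqrt k.+1%:R - Num.sqrt k%:R) :> R.
Proof.
have p0 : 0 < Num.sqrt k.+1%:R :> R by rewrite sqrtr_gt0 ltr0n.
have q0 : 0 <= Num.sqrt k%:R :> R by exact: sqrtr_ge0.
have pp : Num.sqrt k.+1%:R ^+ 2 = k%:R + 1 :> R by rewrite sqr_sqrtr// -natr1.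
have qq : Num.sqrt k%:R ^+ 2 = k%:R :> R by rewrite sqr_sqrtr.
rewrite -[leLHS]div1r ler_pdivrMr//.
move: p0 q0 pp qq; set p := Num.sqrt _; set q := Num.sqrt _ => p0 q0 pp qq.
have := sqr_ge0 (p - q); nra.
Qed.

(** The potential is [sqdist (th k) u]. Of the constant 3, one unit comes from the weighted
    telescoping of this potential and two from summing [r * G / sqrt t]. The point [th k] is the one
    played at round [k.+1]. *)
Lemma ogd_regret (c u : I -> R) (r G : R) (eta : nat -> R)
    (th g : nat -> I -> R) (T : nat) :
  0 < r -> 0 < G -> sqdist u c <= r ^+ 2 ->
  (forall t, eta t = 2 * r / G * (Num.sqrt t%:R)^-1) ->
  th 0%N = c ->
  (forall k, (k < T)%N ->
     th k.+1 = ball_proj c r (fun i => th k i - eta k.+1 * g k.+1 i)) ->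
  (forall t, (1 <= t <= T)%N -> \sum_i g t i ^+ 2 <= G ^+ 2) ->
  \sum_(1 <= t < T.+1) \sum_i g t i * (th t.-1 i - u i)
    <= 3 * G * r * Num.sqrt T%:R.
Proof.
move=> r0 G0 uc etaE th0 thS gG.
have thc k : (k <= T)%N -> sqdist (th k) c <= r ^+ 2.
  case: k => [_|k kT].
    rewrite th0 /sqdist big1 ?sqr_ge0// => i _.
    by rewrite subrr expr0n.
  by rewrite thS//; apply: sqdist_ball_proj_center; exact: ltW.
(* The expansion of the squared distance after one step, divided by [2 * eta k.+1]; the step size
   makes the two coefficients [G * s / (4 * r)] and [r * G / s]. *)
have step k : (k < T)%N ->
    \sum_i g k.+1 i * (th k i - u i) <=
    G / (4 * r) * Num.sqrt k.+1%:R * (sqdist (th k) u - sqdist (th k.+1) u)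
    + r * G * (Num.sqrt k.+1%:R)^-1.
  move=> kT; set S := \sum_i _; set s := Num.sqrt _.
  have s0 : 0 < s by rewrite sqrtr_gt0 ltr0n.
  have e0 : 0 < eta k.+1 by rewrite etaE mulr_gt0 ?invr_gt0// divr_gt0 ?mulr_gt0.
  have H1 : sqdist (th k.+1) u <=
      sqdist (th k) u - 2 * eta k.+1 * S + eta k.+1 ^+ 2 * \sum_i g k.+1 i ^+ 2.
    rewrite thS//; apply: le_trans (sqdist_ball_proj _ (ltW r0) uc) _.
    rewrite le_eqVlt; apply/orP; left; apply/eqP.
    rewrite /sqdist /S !mulr_sumr -sumrB -big_split /=.
    by apply: eq_bigr => i _; ring.
  have H2 : \sum_i g k.+1 i ^+ 2 <= G ^+ 2 by exact: gG.
  have H3 : 2 * eta k.+1 * S <=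
      sqdist (th k) u - sqdist (th k.+1) u + eta k.+1 ^+ 2 * G ^+ 2.
    have : eta k.+1 ^+ 2 * \sum_i g k.+1 i ^+ 2 <= eta k.+1 ^+ 2 * G ^+ 2.
      by rewrite ler_pM2l// exprn_gt0.
    by lra.
  rewrite -(@ler_pM2l _ (2 * eta k.+1)) ?mulr_gt0//.
  apply: (le_trans H3).
  rewrite le_eqVlt; apply/orP; left; apply/eqP.
  rewrite etaE -/s; field.
  by rewrite !gt_eqF.
(* [G / (4 r) * sqrt k = 1 / (2 eta_k)] is nondecreasing in [k], and
   [4 r^2] bounds every [sqdist (th k) u]. *)
have main k : (k <= T)%N ->
    \sum_(1 <= t < k.+1) \sum_i g t i * (th t.-1 i - u i) <=
    G / (4 * r) * Num.sqrt k%:R * (4 * r ^+ 2 - sqdist (th k) u)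
    + 2 * r * G * Num.sqrt k%:R.
  elim: k => [_|k IH kT].
    by rewrite big_nil sqrtr0 !mulr0 mul0r addr0.
  rewrite big_nat_recr//=.
  have := IH (ltnW kT); have := step _ kT.
  have := inv_sqrt_le k; set p := Num.sqrt k.+1%:R; set q := Num.sqrt k%:R => pq.
  have qp : q <= p by rewrite ler_sqrt// ler_nat.
  have A0 : 0 <= 4 * r ^+ 2 - sqdist (th k) u.
    by rewrite subr_ge0; apply: sqdist_ball uc; [exact: ltW|exact/thc/ltnW].
  have GR : 0 <= G / (4 * r) by rewrite divr_ge0 ?mulr_ge0 ?ltW.
  have : G / (4 * r) * q * (4 * r ^+ 2 - sqdist (th k) u) <=
      G / (4 * r) * p * (4 * r ^+ 2 - sqdist (th k) u).
    by rewrite ler_wpM2r// ler_wpM2l.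
  have : r * G * p^-1 <= r * G * (2 * (p - q)) by rewrite ler_wpM2l// mulr_ge0 ?ltW.
  by lra.
apply: (le_trans (main T (leqnn _))).
have s0 : 0 <= Num.sqrt T%:R :> R by exact: sqrtr_ge0.
have -> : 3 * G * r * Num.sqrt T%:R =
    G / (4 * r) * Num.sqrt T%:R * (4 * r ^+ 2) + 2 * r * G * Num.sqrt T%:R.
  by field; rewrite gt_eqF.
rewrite lerD2r; apply: ler_wpM2l; last by rewrite lerBlDr lerDl sqdist_ge0.
by rewrite mulr_ge0// divr_ge0// ?mulr_ge0// ltW.
Qed.

End online_gradient_descent.

(** * The linearized network *)

Section activation.
Context (R : realType) (sigma : R -> R) (C : R).
Hypothesis dsigma : forall z : R, derivable sigma z 1.
Hypothesis lip_dsigma :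
  forall z z' : R, `|derive1 sigma z - derive1 sigma z'| <= C * `|z - z'|.

(** By the mean value theorem the increment is [sigma'] at a point within [|h|] of [z], times [h];
    the Lipschitz bound on [sigma'] does the rest. *)
Lemma activation_taylor (z h : R) :
  `|sigma (z + h) - sigma z - derive1 sigma z * h| <= C * h ^+ 2.
Proof.
have C0 : 0 <= C.
  by have := lip_dsigma 1 0; rewrite subr0 normr1 mulr1; apply: le_trans.
have dE (y : R) : is_derive y 1 sigma (derive1 sigma y).
  by rewrite derive1E; exact: derivableP.
have cont : continuous sigma.
  by move=> y; apply/differentiable_continuous/derivable1_diffP.
have key (a b : R) : a <= b -> exists2 c : R,
    a <= c <= b & sigma b - sigma a = derive1 sigma c * (b - a).
  move=> ab; have [c cab E] := MVT_segment ab (fun y _ => dE y)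
    (continuous_subspaceT cont).
  by exists c => //; move: cab; rewrite in_itv.
have fin (c : R) : `|c - z| <= `|h| ->
    sigma (z + h) - sigma z = derive1 sigma c * h ->
    `|sigma (z + h) - sigma z - derive1 sigma z * h| <= C * h ^+ 2.
  move=> ch ->; rewrite -mulrBl normrM.
  rewrite -[h ^+ 2]real_normK ?num_real// expr2 mulrA ler_wpM2r//.
  by apply: le_trans (lip_dsigma _ _) _; rewrite ler_wpM2l.
have [h0|h0] := leP 0 h.
  have [|c /andP[c1 c2] E] := key z (z + h); first by rewrite lerDl.
  apply: (fin c); last by rewrite E addrAC subrr add0r.
  by rewrite (ger0_norm h0) ger0_norm; lra.
have [|c /andP[c1 c2] E] := key (z + h) z; first by rewrite gerDl ltW.
apply: (fin c); first by rewrite (ltr0_norm h0) ler0_norm; lra.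
by have -> : sigma (z + h) - sigma z = - (sigma z - sigma (z + h));
  [rewrite opprB|rewrite E; ring].
Qed.

End activation.

(** * Differentials of convex Lipschitz losses *)

Section losses.
Context (R : realType) (d : nat) (l : 'rV[R]_d -> R).
Implicit Types u v w : 'rV[R]_d.

(** The differential is the right limit at 0 of difference quotients. Both convexity and the
    Lipschitz property are turned into bounds on the differential this way. *)
Lemma diff_le u w (c : R) : differentiable l u ->
  (forall h : R, 0 < h < 1 -> l (u + h *: w) - l u <= h * c) -> 'd l u w <= c.
Proof.
move=> dl H; rewrite -deriveE//.
have cv : h^-1 *: (l (h *: w + u) - l u) @[h --> (0 : R)^'] --> 'D_w l u.
  exact: (diff_derivable (v := w) dl).
have cvr : h^-1 *: (l (h *: w + u) - l u) @[h --> (0 : R)^'+] --> 'D_w l u.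
  exact: cvg_dnbhs_at_right cv.
apply: (cvgr_to_le cvr); near=> h.
have h0 : 0 < h by [].
have h1 : h < 1 by near: h; apply: nbhs_right_lt.
rewrite -[_ *: _]/(_ * _) mulrC ler_pdivrMr// addrC mulrC.
by rewrite [_ *: _ + _]addrC addrC H// h0.
Unshelve. all: by end_near. Qed.

Definition partials u (i : 'I_d) : R := 'd l u (delta_mx 0 i).

Lemma diffE_partials u w : 'd l u w = \sum_i partials u i * w 0 i.
Proof.
rewrite [in LHS](row_sum_delta w) linear_sum; apply: eq_bigr => i _.
by rewrite linearZ /= mulrC.
Qed.

Lemma convex_diff_le u v : differentiable l u ->
  (forall (u v : 'rV[R]_d) (lam : R), 0 <= lam <= 1 ->
      l (lam *: u + (1 - lam) *: v) <= lam * l u + (1 - lam) * l v) ->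
  l u - l v <= \sum_i partials u i * (u 0 i - v 0 i).
Proof.
move=> dl cvx.
have : 'd l u (v - u) <= l v - l u.
  apply: diff_le => // h /andP[h0 h1].
  have := cvx v u h; rewrite (ltW h0) (ltW h1) => /(_ isT).
  have -> : h *: v + (1 - h) *: u = u + h *: (v - u).
    by rewrite scalerBl scale1r scalerBr addrCA addrA.
  by lra.
rewrite diffE_partials.
have -> : \sum_i partials u i * (v - u) 0 i =
    - \sum_i partials u i * (u 0 i - v 0 i).
  by rewrite -sumrN; apply: eq_bigr => i _; rewrite !mxE; ring.
by lra.
Qed.

Lemma eucl_normZ w (h : R) : 0 <= h -> eucl_norm (h *: w) = h * eucl_norm w.
Proof.
move=> h0; rewrite /eucl_norm.
rewrite (eq_bigr (fun i => h ^+ 2 * w 0 i ^+ 2)); last first.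
  by move=> i _; rewrite mxE exprMn.
by rewrite -mulr_sumr sqrtrM ?sqr_ge0// sqrtr_sqr ger0_norm.
Qed.

Lemma sqr_eucl_norm w : eucl_norm w ^+ 2 = \sum_i w 0 i ^+ 2.
Proof. by rewrite sqr_sqrtr// sumr_ge0// => i _; exact: sqr_ge0. Qed.

(** Testing the differential on the gradient itself gives [|w|^2 = 'd l u w <= L |w|]. *)
Lemma partials_sqr_le u (L : R) : 0 < L -> differentiable l u ->
  (forall u v : 'rV[R]_d, `|l u - l v| <= L * eucl_norm (u - v)) ->
  \sum_i partials u i ^+ 2 <= L ^+ 2.
Proof.
move=> L0 dl lip.
pose w : 'rV[R]_d := \row_i partials u i.
have wE : \sum_i partials u i ^+ 2 = eucl_norm w ^+ 2.
  by rewrite sqr_eucl_norm; apply: eq_bigr => i _; rewrite mxE.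
have dw : 'd l u w <= L * eucl_norm w.
  apply: diff_le => // h /andP[h0 _].
  apply: le_trans (ler_norm _) _; apply: le_trans (lip _ _) _.
  by rewrite addrAC subrr add0r eucl_normZ ?(ltW h0)// mulrCA.
rewrite wE; have N0 : 0 <= eucl_norm w by exact: sqrtr_ge0.
have : eucl_norm w ^+ 2 <= L * eucl_norm w.
  rewrite -wE; apply: le_trans dw; rewrite diffE_partials.
  by apply: ler_sum => i _; rewrite mxE expr2.
by nra.
Qed.

End losses.

(** Chain rule along a fixed direction: varying a single weight moves the network output along one
    coordinate vector only. *)
Lemma derive1_comp_line (R : realType) d (l : 'rV[R]_d -> R) (u w : 'rV[R]_d)
    (B : R -> R) (b : R) :
  differentiable l u -> is_derive (0 : R) 1 B b -> B 0 = 0 ->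
  derive1 (fun h => l (u + B h *: w)) 0 = b * 'd l u w.
Proof.
move=> dl dB B0.
have dBd : differentiable B 0 by apply/derivable1_diffP; case: dB.
have dBw : differentiable (fun h => B h *: w) 0 by exact: differentiableZl.
pose q : R -> 'rV[R]_d := cst u + (fun h => B h *: w).
have q0 : q 0 = u by rewrite /q /= !fctE B0 scale0r addr0.
have dq : differentiable q 0 by exact: differentiableD.
have dq1 : 'd q (0 : R) (1 : R) = b *: w.
  have dc : differentiable (cst u : R -> 'rV[R]_d) 0 by exact: differentiable_cst.
  have E1 : 'd B (0 : R) (1 : R) = b by rewrite -derive1E'// derive1E; case: dB.
  rewrite [LHS](congr1 (fun f : R -> 'rV[R]_d => f 1) (diffD dc dBw)) /=.
  rewrite [X in X + _](congr1 (fun f : R -> 'rV[R]_d => f 1) (diff_cst u 0)).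
  rewrite [X in _ + X](congr1 (fun f : R -> 'rV[R]_d => f 1) (diffZl w dBd)).
  by rewrite E1 add0r.
have dlq : differentiable l (q 0) by rewrite q0.
have -> : (fun h => l (u + B h *: w)) = l \o q by [].
rewrite derive1E'; last exact: differentiable_comp.
rewrite [LHS](congr1 (fun f : R -> R => f 1) (diff_comp dq dlq)) /=.
rewrite dq1.
rewrite q0.
by rewrite linearZ.
Qed.

(** * Gradient of the loss in the network parameters *)

Section network.
Context (R : realType) (d n p : nat).
Notation param := (param R d n p).
Implicit Types (th U c : param) (a : 'I_d -> 'I_n -> bool) (x : 'I_p -> R).

Definition flat th : 'I_d * 'I_(n + n) * 'I_p -> R := fun z => th z.1.1 z.1.2 z.2.

Lemma sum_flat (F : 'I_d -> 'I_(n + n) -> 'I_p -> R) :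
  \sum_z F z.1.1 z.1.2 z.2 = \sum_i \sum_r \sum_k F i r k.
Proof.
rewrite pair_big /= pair_big /=.
by apply: eq_bigr => -[[i r] k] _.
Qed.

Lemma frob_distE th c : frob_dist th c = Num.sqrt (sqdist (flat th) (flat c)).
Proof. by rewrite /frob_dist -(sum_flat (fun i r k => (th i r k - c i r k) ^+ 2)). Qed.

Lemma flat_proj_ball c r th : flat (proj_ball c r th) = ball_proj (flat c) r (flat th).
Proof.
by apply/funext => z; rewrite /flat /proj_ball /ball_proj frob_distE; case: ifP.
Qed.

Definition preact th i r x : R := \sum_(k < p) th i r k * x k.

(** The index [i] names the output and the parameter block at once, since output [i] depends on
    block [i] only. *)
Definition jac (sigma : R -> R) a th x i r k : R :=
  (Num.sqrt (n + n)%:R)^-1 * coef R a i r * derive1 sigma (preact th i r x) * x k.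

Lemma sqr_coef a i r : coef R a i r ^+ 2 = 1.
Proof.
by rewrite /coef /sgn; case: (fintype.split r) => j; case: (a i j);
  rewrite ?sqrrN ?expr1n.
Qed.

Lemma normr_coef a i r : `|coef R a i r| = 1.
Proof.
by rewrite /coef /sgn; case: (fintype.split r) => j; case: (a i j);
  rewrite ?opprK ?normrN ?normr1.
Qed.

Lemma grad_net (sigma : R -> R) a th x (l : 'rV[R]_d -> R) i r k :
  (forall z, derivable sigma z 1) ->
  differentiable l (net sigma a th x) ->
  grad (fun th' => l (net sigma a th' x)) th i r k =
  partials l (net sigma a th x) i * jac sigma a th x i r k.
Proof.
move=> ds dl; rewrite /grad.
set u := net sigma a th x in dl *.
pose b := (Num.sqrt (n + n)%:R)^-1 * coef R a i r.
pose z := preact th i r x.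
(* The change of output [i] when the entry [(i, r, k)] is increased by [h]; all other outputs stay
   fixed. *)
pose B (h : R) : R := b * (sigma (z + h * x k) - sigma z).
have -> : (fun h : R => l (net sigma a (fun i' r' k' => th i' r' k' +
    (if [&& i' == i, r' == r & k' == k] then h else 0)) x)) =
    (fun h => l (u + B h *: delta_mx 0 i)).
  apply/funext => h /=; congr l; apply/rowP => i'; rewrite !mxE eqxx /=.
  have [->|ii'] := eqVneq i' i; last first.
    rewrite mulr0 addr0; congr (_ * _); apply: eq_bigr => r' _.
    by congr (_ * sigma _); apply: eq_bigr => k' _; rewrite addr0.
  rewrite mulr1 (bigD1 r)//= [in RHS](bigD1 r)//= eqxx /=.
  have -> : \sum_(k0 < p) (th i r k0 + (if k0 == k then h else 0)) * x k0 =
      z + h * x k.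
    rewrite (eq_bigr (fun k0 => th i r k0 * x k0 + (if k0 == k then h * x k else 0))).
      by rewrite big_split /= -big_mkcond big_pred1_eq.
    by move=> k0 _; rewrite mulrDl; case: eqP => [->|_]; rewrite ?mul0r.
  rewrite (eq_bigr (fun r' => coef R a i r' * sigma (\sum_(k0 < p) th i r' k0 * x k0))).
    by rewrite /B /b -/(preact th i r x) -/z; ring.
  move=> r' rr'; rewrite (negbTE rr'); congr (_ * sigma _).
  by apply: eq_bigr => k' _; rewrite addr0.
have B0 : B 0 = 0 by rewrite /B mul0r addr0 subrr mulr0.
have dB : is_derive (0 : R) 1 B (b * (derive1 sigma z * x k)).
  have dsz : is_derive (z + 0 * x k) 1 sigma (derive1 sigma z).
    by rewrite mul0r addr0 derive1E; exact: derivableP.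
  have daff : is_derive (0 : R) 1 (fun h : R => z + h * x k) (x k).
    have -> : (fun h : R => z + h * x k) = cst z + x k *: id.
      by apply/funext => h; rewrite /= mulrC.
    have := is_deriveD (is_derive_cst z (0 : R) 1) (is_deriveZ (x k) (is_derive_id (0 : R) 1)).
    by rewrite add0r -[_ *: 1]/(_ * 1) mulr1.
  have dc := @is_derive1_comp _ sigma (fun h => z + h * x k) 0 _ _ dsz daff.
  have dd := is_deriveB dc (is_derive_cst (sigma z) (0 : R) 1).
  by have := is_deriveZ b dd; rewrite subr0.
by rewrite (derive1_comp_line _ dl dB B0) /partials /jac -/z -/b; ring.
Qed.

End network.

(** * Linearization error and regret of the trajectory *)

Section linearization.
Context (R : realType) (d n p : nat) (sigma : R -> R) (C : R).
Notation param := (param R d n p).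
Implicit Types (th U : param) (a : 'I_d -> 'I_n -> bool) (x : 'I_p -> R).
Hypothesis n0 : (0 < n)%N.
Hypothesis dsigma : forall z : R, derivable sigma z 1.
Hypothesis lip_dsigma :
  forall z z' : R, `|derive1 sigma z - derive1 sigma z'| <= C * `|z - z'|.
Hypothesis dsigma_le : forall z : R, `|derive1 sigma z| <= C.

Let C0 : 0 <= C. Proof. exact: le_trans (normr_ge0 _) (dsigma_le 0). Qed.

Let m0 : 0 < (n + n)%:R :> R. Proof. by rewrite ltr0n addn_gt0 n0. Qed.

Let sm0 : 0 < Num.sqrt (n + n)%:R :> R. Proof. by rewrite sqrtr_gt0. Qed.

Lemma preact_sqr_le th U i r x : \sum_k x k ^+ 2 = 1 ->
  (preact U i r x - preact th i r x) ^+ 2 <= \sum_k (U i r k - th i r k) ^+ 2.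
Proof.
move=> x1.
have -> : preact U i r x - preact th i r x = \sum_k (U i r k - th i r k) * x k.
  by rewrite -sumrB; apply: eq_bigr => k _; rewrite mulrBl.
by apply: le_trans (sum_mul_sqr_le _ _) _; rewrite x1 mulr1.
Qed.

(** Each hidden unit has remainder at most [C] times the squared change of its preactivation, hence
    of its weight row as [|x| = 1]. The signs have modulus 1, so the prefactor [1 / sqrt m]
    survives. *)
Lemma net_taylor a th U i x : \sum_k x k ^+ 2 = 1 ->
  `|net sigma a U x 0 i - net sigma a th x 0 i -
    \sum_r \sum_k jac sigma a th x i r k * (U i r k - th i r k)| <=
  C / Num.sqrt (n + n)%:R * \sum_r \sum_k (U i r k - th i r k) ^+ 2.
Proof.
move=> x1; rewrite !mxE; have s0 := sm0; set s := Num.sqrt _ in s0 *.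
have -> : s^-1 * (\sum_(r < n + n) coef R a i r * sigma (preact U i r x)) -
    s^-1 * (\sum_(r < n + n) coef R a i r * sigma (preact th i r x)) -
    \sum_r \sum_k jac sigma a th x i r k * (U i r k - th i r k) =
  s^-1 * \sum_r coef R a i r * (sigma (preact th i r x +
      (preact U i r x - preact th i r x)) - sigma (preact th i r x) -
      derive1 sigma (preact th i r x) * (preact U i r x - preact th i r x)).
  rewrite !mulr_sumr -!sumrB; apply: eq_bigr => r _.
  rewrite [preact th i r x + _]addrC subrK.
  have -> : \sum_k jac sigma a th x i r k * (U i r k - th i r k) =
      s^-1 * coef R a i r * derive1 sigma (preact th i r x) *
      (preact U i r x - preact th i r x).
    rewrite -sumrB mulr_sumr; apply: eq_bigr => k _.
    by rewrite /jac -/s; ring.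
  by ring.
rewrite normrM ger0_norm ?invr_ge0 ?(ltW s0)// [C / s]mulrC -mulrA.
rewrite ler_pM2l ?invr_gt0// mulr_sumr.
apply: le_trans (ler_norm_sum _ _ _) _; apply: ler_sum => r _.
rewrite normrM normr_coef mul1r.
apply: le_trans (activation_taylor dsigma lip_dsigma _ _) _.
by rewrite ler_wpM2l//; exact: preact_sqr_le.
Qed.

(** Each of the [m] rows contributes at most [C ^+ 2 / m]. *)
Lemma jac_sqr_le a th i x : \sum_k x k ^+ 2 = 1 ->
  \sum_r \sum_k jac sigma a th x i r k ^+ 2 <= C ^+ 2.
Proof.
move=> x1.
apply: (@le_trans _ _ (\sum_(r < n + n) C ^+ 2 / (n + n)%:R)); last first.
  by rewrite sumr_const card_ord -[leLHS]mulr_natr divfK// gt_eqF.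
apply: ler_sum => r _.
have -> : \sum_k jac sigma a th x i r k ^+ 2 =
    derive1 sigma (preact th i r x) ^+ 2 / (n + n)%:R.
  transitivity (derive1 sigma (preact th i r x) ^+ 2 / (n + n)%:R * \sum_k x k ^+ 2).
    2: by rewrite x1 mulr1.
  rewrite mulr_sumr; apply: eq_bigr => k _.
  by rewrite /jac !exprMn sqr_coef exprVn sqr_sqrtr ?(ltW m0)//; ring.
rewrite ler_pM2r ?invr_gt0// -[leLHS]real_normK ?num_real//.
by rewrite ler_pXn2r// nnegrE.
Qed.

(** Convexity bounds the loss gap by the output gradient against the output difference, and
    [net_taylor] replaces that difference by its linear part. *)
Lemma loss_linearization a th U x (l : 'rV[R]_d -> R) (L : R) :
  0 < L -> \sum_k x k ^+ 2 = 1 ->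
  (forall (u v : 'rV[R]_d) (lam : R), 0 <= lam <= 1 ->
      l (lam *: u + (1 - lam) *: v) <= lam * l u + (1 - lam) * l v) ->
  (forall u : 'rV[R]_d, differentiable l u) ->
  (forall u v : 'rV[R]_d, `|l u - l v| <= L * eucl_norm (u - v)) ->
  l (net sigma a th x) - l (net sigma a U x) <=
  \sum_z flat (grad (fun th' => l (net sigma a th' x)) th) z *
           (flat th z - flat U z)
  + L * C / Num.sqrt (n + n)%:R * sqdist (flat U) (flat th).
Proof.
move=> L0 x1 cvx dl lip.
set u := net sigma a th x; set v := net sigma a U x.
have G2 := partials_sqr_le L0 (dl u) lip.
(* The remainder of output [i] involves block [i] only, so bounding each partial by [L] sums the
   remainders to [sqdist] without a factor depending on [d]. *)
have GL i : `|partials l u i| <= L.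
  rewrite -(@ler_pXn2r _ 2)// ?nnegrE ?(ltW L0)// real_normK ?num_real//.
  apply: le_trans G2; rewrite (bigD1 i)//= lerDl.
  by apply: sumr_ge0 => j _; exact: sqr_ge0.
apply: (le_trans (convex_diff_le v (dl u) cvx)).
rewrite (eq_bigr (fun z : 'I_d * 'I_(n + n) * 'I_p => partials l u z.1.1 *
    jac sigma a th x z.1.1 z.1.2 z.2 *
    (th z.1.1 z.1.2 z.2 - U z.1.1 z.1.2 z.2))); last first.
  by move=> z _; rewrite /flat grad_net.
rewrite (sum_flat (fun i r k => partials l u i * jac sigma a th x i r k *
  (th i r k - U i r k))).
rewrite /sqdist /flat (sum_flat (fun i r k => (U i r k - th i r k) ^+ 2)).
rewrite mulr_sumr -big_split /=; apply: ler_sum => i _.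
have -> : \sum_r \sum_k partials l u i * jac sigma a th x i r k *
     (th i r k - U i r k) =
   - (partials l u i * \sum_r \sum_k jac sigma a th x i r k * (U i r k - th i r k)).
  rewrite mulr_sumr -sumrN; apply: eq_bigr => r _.
  by rewrite mulr_sumr -sumrN; apply: eq_bigr => k _; ring.
have := net_taylor a th U i x1; rewrite -/u -/v.
set J := \sum_r \sum_k _; set S := \sum_r \sum_k _; have s0 := sm0; set s := Num.sqrt _ in s0 *.
move=> H; rewrite addrC -subr_le0.
have -> : partials l u i * (u 0 i - v 0 i) - (L * C / s * S + - (partials l u i * J)) =
   partials l u i * - (v 0 i - u 0 i - J) - L * (C / s * S) by ring.
rewrite subr_le0; apply: le_trans (ler_norm _) _.
by rewrite normrM normrN; apply: ler_pM.
Qed.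

Lemma grad_sqr_le a th x (l : 'rV[R]_d -> R) (L : R) :
  0 < L -> \sum_k x k ^+ 2 = 1 ->
  (forall u : 'rV[R]_d, differentiable l u) ->
  (forall u v : 'rV[R]_d, `|l u - l v| <= L * eucl_norm (u - v)) ->
  \sum_z flat (grad (fun th' => l (net sigma a th' x)) th) z ^+ 2 <= (C * L) ^+ 2.
Proof.
move=> L0 x1 dl lip; set u := net sigma a th x.
rewrite (eq_bigr (fun z : 'I_d * 'I_(n + n) * 'I_p => (partials l u z.1.1 *
    jac sigma a th x z.1.1 z.1.2 z.2) ^+ 2)); last first.
  by move=> z _; rewrite /flat grad_net.
rewrite (sum_flat (fun i r k => (partials l u i * jac sigma a th x i r k) ^+ 2)).
apply: (@le_trans _ _ (C ^+ 2 * \sum_i partials l u i ^+ 2)); last first.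
  by rewrite exprMn ler_wpM2l ?sqr_ge0//; exact: partials_sqr_le.
rewrite mulr_sumr; apply: ler_sum => i _.
have -> : \sum_r \sum_k (partials l u i * jac sigma a th x i r k) ^+ 2 =
    (\sum_r \sum_k jac sigma a th x i r k ^+ 2) * partials l u i ^+ 2.
  rewrite mulr_suml; apply: eq_bigr => r _.
  by rewrite mulr_suml; apply: eq_bigr => k _; rewrite exprMn mulrC.
by rewrite ler_wpM2r ?sqr_ge0//; exact: jac_sqr_le.
Qed.

(** [ogd_regret] with [G = C * L], plus a linearization error in each round; there [U] and the
    iterate both lie in the ball of radius [r], hence the factor [4 * r ^+ 2]. *)
Lemma traj_regret a (W : 'I_d -> 'I_n -> 'I_p -> R) (r L : R) (T : nat)
    (eta : nat -> R) (x : nat -> 'I_p -> R) (l : nat -> 'rV[R]_d -> R) U :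
  0 < C -> 0 < L -> 0 < r ->
  (forall t, eta t = 2 * r / (C * L) * (Num.sqrt t%:R)^-1) ->
  (forall t, (1 <= t <= T)%N -> \sum_k x t k ^+ 2 = 1) ->
  (forall t, (1 <= t <= T)%N -> forall (u v : 'rV[R]_d) (lam : R), 0 <= lam <= 1 ->
      l t (lam *: u + (1 - lam) *: v) <= lam * l t u + (1 - lam) * l t v) ->
  (forall t, (1 <= t <= T)%N -> forall u : 'rV[R]_d, differentiable (l t) u) ->
  (forall t, (1 <= t <= T)%N -> forall u v : 'rV[R]_d,
      `|l t u - l t v| <= L * eucl_norm (u - v)) ->
  sqdist (flat U) (flat (init W)) <= r ^+ 2 ->
  \sum_(1 <= t < T.+1)
     l t (net sigma a (traj sigma a W r eta x l t.-1) (x t)) <=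
  \sum_(1 <= t < T.+1) l t (net sigma a U (x t))
  + 3 * (C * L) * r * Num.sqrt T%:R
  + 4 * r ^+ 2 * L * C * T%:R / Num.sqrt (n + n)%:R.
Proof.
move=> Cp L0 r0 etaE x1 cvx dl lip Ur.
pose th k := traj sigma a W r eta x l k.
pose g t := grad (fun th' => l t (net sigma a th' (x t))) (th t.-1).
have thS k : flat (th k.+1) =
    ball_proj (flat (init W)) r (fun z => flat (th k) z - eta k.+1 * flat (g k.+1) z).
  by rewrite /th /= flat_proj_ball.
have thr k : sqdist (flat (th k)) (flat (init W)) <= r ^+ 2.
  case: k => [|k]; last by rewrite thS; apply/sqdist_ball_proj_center/ltW.
  rewrite /sqdist big1 ?sqr_ge0// => z _.
  by rewrite subrr expr0n.
have reg := @ogd_regret _ _ (flat (init W)) (flat U) r (C * L) eta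
  (fun k => flat (th k)) (fun t => flat (g t)) T r0 (mulr_gt0 Cp L0) Ur etaE
  erefl (fun k _ => thS k)
  (fun t tT => grad_sqr_le a (th t.-1) L0 (x1 t tT) (dl t tT) (lip t tT)).
rewrite -addrA -lerBlDl -sumrB.
apply: (@le_trans _ _ (\sum_(1 <= t < T.+1)
  (\sum_z flat (g t) z * (flat (th t.-1) z - flat U z) +
    4 * r ^+ 2 * L * C / Num.sqrt (n + n)%:R))).
  rewrite big_nat [leRHS]big_nat; apply: ler_sum => t; rewrite ltnS => tT.
  apply: le_trans (loss_linearization a (th t.-1) U L0 (x1 t tT) (cvx t tT)
    (dl t tT) (lip t tT)) _.
  rewrite lerD2l.
  have -> : 4 * r ^+ 2 * L * C / Num.sqrt (n + n)%:R =
    L * C / Num.sqrt (n + n)%:R * (4 * r ^+ 2) by ring.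
  apply: ler_wpM2l; last by apply: sqdist_ball Ur (thr _); exact: ltW.
  by rewrite divr_ge0 ?sqrtr_ge0// mulr_ge0 ?(ltW L0).
rewrite big_split /= sumr_const_nat subn1 /=.
apply: lerD; first by [].
by rewrite -mulr_natr le_eqVlt; apply/orP; left; apply/eqP; ring.
Qed.

End linearization.

(** * The random-feature comparator *)

Section comparator.
Context (R : realType) (d n p : nat) (sigma : R -> R) (C D : R).
Hypothesis n0 : (0 < n)%N.
Hypothesis dsigma : forall z : R, derivable sigma z 1.
Hypothesis lip_dsigma :
  forall z z' : R, `|derive1 sigma z - derive1 sigma z'| <= C * `|z - z'|.
Hypothesis dsigma_le : forall z : R, `|derive1 sigma z| <= C.
Variables (a : 'I_d -> 'I_n -> bool) (W rho : 'I_d -> 'I_n -> 'I_p -> R).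
Hypothesis rho_le : forall i j, \sum_k rho i j k ^+ 2 <= D ^+ 2.

Let C0 : 0 <= C. Proof. exact: le_trans (normr_ge0 _) (dsigma_le 0). Qed.

Let m0 : 0 < (n + n)%:R :> R. Proof. by rewrite ltr0n addn_gt0 n0. Qed.

Let sm0 : 0 < Num.sqrt (n + n)%:R :> R. Proof. by rewrite sqrtr_gt0. Qed.

(** Rows come in pairs with equal initial weights; both rows of a pair are sent to the hidden unit
    they copy. *)
Definition hidden_index (r : 'I_(n + n)) : 'I_n :=
  match fintype.split r with inl j => j | inr j => j end.

Lemma hidden_index_lshift j : hidden_index (lshift n j) = j.
Proof. by rewrite /hidden_index (unsplitK (inl j)). Qed.

Lemma hidden_index_rshift j : hidden_index (rshift n j) = j.
Proof. by rewrite /hidden_index (unsplitK (inr j)). Qed.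

Lemma sum_hidden_index (F : 'I_n -> R) : \sum_r F (hidden_index r) = 2 * \sum_j F j.
Proof.
rewrite big_split_ord /= mulr_natl mulr2n; congr (_ + _).
  by apply: eq_bigr => j _; rewrite hidden_index_lshift.
by apply: eq_bigr => j _; rewrite hidden_index_rshift.
Qed.

Lemma initE i r k : init W i r k = W i (hidden_index r) k.
Proof. by rewrite /init /hidden_index; case: fintype.split. Qed.

Lemma net_init x i : net sigma a (init W) x 0 i = 0.
Proof.
rewrite mxE big_split_ord /= -big_split /= big1 ?mulr0// => j _.
under eq_bigr do rewrite initE hidden_index_lshift.
under [X in _ + _ * sigma X]eq_bigr do rewrite initE hidden_index_rshift.
by rewrite /coef (unsplitK (inl j)) (unsplitK (inr j)) /= mulNr subrr.
Qed.

(** The displacement carries the sign [coef], so that in the linear part it meets the sign of [jac]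
    and squares to 1: paired rows add up instead of cancelling. *)
Definition comparator : param R d n p := fun i r k =>
  init W i r k + coef R a i r / Num.sqrt (n + n)%:R * rho i (hidden_index r) k.

Definition emp_mean (x : 'I_p -> R) (i : 'I_d) : R :=
  n%:R^-1 * \sum_j (\sum_k rho i j k * x k) * derive1 sigma (\sum_k W i j k * x k).

Lemma comparator_row_sqr i :
  \sum_r \sum_k (comparator i r k - init W i r k) ^+ 2 <= D ^+ 2.
Proof.
apply: (@le_trans _ _ (\sum_(r < n + n) D ^+ 2 / (n + n)%:R)); last first.
  by rewrite sumr_const card_ord -[leLHS]mulr_natr divfK// gt_eqF.
apply: ler_sum => r _.
have -> : \sum_k (comparator i r k - init W i r k) ^+ 2 =
    (\sum_k rho i (hidden_index r) k ^+ 2) / (n + n)%:R.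
  rewrite mulr_suml; apply: eq_bigr => k _.
  rewrite /comparator addrAC subrr add0r !exprMn sqr_coef exprVn.
  by rewrite sqr_sqrtr ?(ltW m0)// mul1r mulrC.
by rewrite ler_pM2r ?invr_gt0.
Qed.

Lemma comparator_dist :
  sqdist (flat comparator) (flat (init W)) <= (D * Num.sqrt d%:R) ^+ 2.
Proof.
rewrite /sqdist /flat (sum_flat (fun i r k => (comparator i r k - init W i r k) ^+ 2)).
apply: (@le_trans _ _ (\sum_(i < d) D ^+ 2)).
  by apply: ler_sum => i _; exact: comparator_row_sqr.
by rewrite sumr_const card_ord exprMn sqr_sqrtr// mulr_natr.
Qed.

(** The linear part equals [emp_mean] exactly: the two factors [1 / sqrt m] give [1 / m], and each
    hidden unit is counted twice. Only the Taylor remainder is left. *)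
Lemma net_comparator x i : \sum_k x k ^+ 2 = 1 ->
  `|net sigma a comparator x 0 i - emp_mean x i| <= C * D ^+ 2 / Num.sqrt (n + n)%:R.
Proof.
move=> x1.
have := net_taylor n0 dsigma lip_dsigma dsigma_le a (init W) comparator i x1.
rewrite net_init subr0.
have -> : \sum_r \sum_k jac sigma a (init W) x i r k *
     (comparator i r k - init W i r k) = emp_mean x i.
  pose F j := (\sum_k rho i j k * x k) * derive1 sigma (\sum_k W i j k * x k).
  transitivity ((n + n)%:R^-1 * \sum_r F (hidden_index r)); last first.
    rewrite sum_hidden_index /emp_mean -/(F _) mulrA; congr (_ * _).
    have nn0 : n%:R != 0 :> R by rewrite pnatr_eq0 -lt0n.
    by rewrite natrD; field; rewrite nn0 -mulr2n mulrn_eq0.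
  rewrite mulr_sumr; apply: eq_bigr => r _.
  have -> : F (hidden_index r) = \sum_k rho i (hidden_index r) k * x k *
      derive1 sigma (preact (init W) i r x).
    rewrite /F mulr_suml; apply: eq_bigr => k _; congr (_ * derive1 sigma _).
    by apply: eq_bigr => k' _; rewrite initE.
  rewrite mulr_sumr; apply: eq_bigr => k _.
  rewrite /jac /comparator [X in _ * X = _]addrAC subrr add0r.
  set s := Num.sqrt _.
  have -> : (n + n)%:R^-1 = coef R a i r ^+ 2 * s^-1 ^+ 2 :> R.
    by rewrite sqr_coef mul1r exprVn sqr_sqrtr// ltW.
  by ring.
move=> H; apply: (le_trans H).
rewrite mulrAC ler_pM2r ?invr_gt0//.
by apply: ler_wpM2l => //; exact: comparator_row_sqr.
Qed.

End comparator.

Lemma eucl_norm_le (R : realType) d (w : 'rV[R]_d) (b : R) : 0 <= b ->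
  (forall i, `|w 0 i| <= b) -> eucl_norm w <= Num.sqrt d%:R * b.
Proof.
move=> b0 wb; rewrite -[X in _ * X]ger0_norm// -sqrtr_sqr -sqrtrM// ler_wsqrtr//.
rewrite mulr_natl -[X in _ *+ X](card_ord d) -sumr_const; apply: ler_sum => i _.
by rewrite -real_normK ?num_real// ler_pXn2r// nnegrE.
Qed.

(** * Concentration *)

Section moment_generating_function.
Context (R : realType).

(** From [expR (- y) >= 1 - y] and [(1 - y) * (1 + y + 2 * y ^+ 2) = 1 + y ^+ 2 * (1 - 2 * y) >=
    1]. *)
Lemma expR_le_quad (y : R) : `|y| <= 1 / 2 -> expR y <= 1 + y + 2 * y ^+ 2.
Proof.
rewrite ler_norml => /andP[y1 y2].
have ey : expR (- y) * expR y = 1 by rewrite -expRD addNr expR0.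
have := expR_ge1Dx (- y); have := expR_gt0 y; nra.
Qed.

Lemma expR_half_le2 : expR (1 / 2 : R) <= 2.
Proof.
have h : `|1 / 2 : R| <= 1 / 2 by rewrite ger0_norm.
by have := expR_le_quad h; lra.
Qed.

(** In the quadratic bound on the exponential the centered linear term integrates to 0. As the mean
    is also bounded by [B], the quadratic term is at most [2 * (2 * B * s) ^+ 2 <= 1 / (2 * n)]. *)
Lemma integral_centered_exp_le d (T : measurableType d) (Q : probability T R)
    (zeta : T -> R) (B s : R) (n : nat) : (0 < n)%N -> 0 <= B ->
  measurable_fun setT zeta -> (forall y, `|zeta y| <= B) ->
  (4 * B * s) ^+ 2 <= n%:R^-1 ->
  (\int[Q]_y (expR (s * (zeta y - Rintegral Q setT zeta)))%:E <=
     (expR (1 / 2 / n%:R))%:E)%E.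
Proof.
move=> n0 B0 mz zB sB; set mu := Rintegral Q setT zeta.
have muB : `|mu| <= B by exact: normr_Rintegral_le.
have nR : 0 < n%:R :> R by rewrite ltr0n.
have cB y : `|s * (zeta y - mu)| <= `|s| * (B + B).
  rewrite normrM ler_wpM2l// (le_trans (ler_normB _ _))// lerD//.
have sq y : 2 * (s * (zeta y - mu)) ^+ 2 <= 1 / 2 / n%:R.
  have : (s * (zeta y - mu)) ^+ 2 <= (`|s| * (B + B)) ^+ 2.
    rewrite -real_normK ?num_real// ler_pXn2r// nnegrE//.
    by rewrite mulr_ge0// addr_ge0.
  have -> : (`|s| * (B + B)) ^+ 2 = (4 * B * s) ^+ 2 / 4.
    by rewrite exprMn real_normK ?num_real//; field.
  by lra.
have half y : `|s * (zeta y - mu)| <= 1 / 2.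
  have n1 : n%:R^-1 <= 1 :> R by rewrite invf_le1// ler1n.
  rewrite -(@ler_pXn2r _ 2)// ?nnegrE// real_normK ?num_real//.
  by have := sq y; rewrite expr2; lra.
have mc : measurable_fun setT (fun y => s * (zeta y - mu)).
  by apply: measurable_funM => //; exact: measurable_funB.
have ic := bounded_integrable Q mc cB.
apply: (@le_trans _ _ (\int[Q]_y ((1 + 1 / 2 / n%:R)%:E + (s * (zeta y - mu))%:E))%E).
  apply: ge0_le_integral => //.
  - by apply/measurable_EFinP; exact: measurableT_comp.
  - by apply/measurable_EFinP; exact: measurable_funD.
  - move=> y _; rewrite -EFinD lee_fin.
    apply: (le_trans (expR_le_quad (half y))).
    by have := sq y; lra.
rewrite integralD//; last first.
  apply: (@bounded_integrable _ _ _ Q (fun=> 1 + 1 / 2 / n%:R) `|1 + 1 / 2 / n%:R|) => //.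
rewrite integral_cst// [X in (_ * X)%E](probability_setT Q) mule1.
have -> : (\int[Q]_y (s * (zeta y - mu))%:E = 0)%E.
  have iz := bounded_integrable Q mz zB.
  rewrite -[LHS]fineK; last exact: integrable_fin_num.
  rewrite -/(Rintegral Q setT (fun y => s * (zeta y - mu))).
  have icst : Q.-integrable setT (EFin \o (fun=> mu)).
    by apply: (@bounded_integrable _ _ _ Q (fun=> mu) B).
  rewrite RintegralZl//; last first.
    exact: (integrableB measurableT iz icst).
  rewrite RintegralB// Rintegral_cst// [fine _](congr1 fine (probability_setT Q)).
  by rewrite mulr1 subrr mulr0.
by rewrite adde0 lee_fin expR_ge1Dx.
Qed.

(** By independence the integral is an [n]-th power, bounded by
    [expR (1 / (2 * n)) ^+ n = expR (1 / 2)]. *)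
Lemma iid_law_mgf_le2 d (T : measurableType d) (Q : probability T R)
    (zeta : T -> R) (B s : R) (n : nat) : (0 < n)%N -> 0 <= B ->
  measurable_fun setT zeta -> (forall y, `|zeta y| <= B) ->
  (4 * B * s) ^+ 2 <= n%:R^-1 ->
  (\int[iid_law Q n]_t
     (expR (\sum_(j < n) s * (zeta (tnth t j) - Rintegral Q setT zeta)))%:E
   <= 2%:E)%E.
Proof.
move=> n0 B0 mz zB sB; set mu := Rintegral Q setT zeta.
pose F y := expR (s * (zeta y - mu)).
have mF : measurable_fun setT F.
  apply: measurableT_comp => //.
  by apply: measurable_funM => //; exact: measurable_funB.
rewrite (eq_integral (fun t => (\prod_(j < n) F (tnth t j))%:E)); last first.
  by move=> t _; rewrite expR_sum.
rewrite ge0_integral_iid_law_prod//; last by move=> y; exact: expR_ge0.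
have H : (\int[Q]_y (F y)%:E <= (expR (1 / 2 / n%:R))%:E)%E.
  exact: (integral_centered_exp_le Q n0 B0 mz zB sB).
set r := (\int[Q]_y (F y)%:E)%E in H *.
have r0 : (0 <= r)%E by apply: integral_ge0 => y _; rewrite lee_fin expR_ge0.
have rfin : r \is a fin_num by rewrite ge0_fin_numE//; exact: le_lt_trans H (ltry _).
rewrite -[X in (\prod_(k < n) X)%E](fineK rfin) prodEFin lee_fin.
rewrite prodr_const card_ord; apply: le_trans expR_half_le2.
have -> : 1 / 2 = n%:R * (1 / 2 / n%:R) :> R.
  by rewrite [RHS]mulrC divfK// pnatr_eq0 -lt0n.
rewrite expRM_natl; apply: lerXn2r; rewrite ?nnegrE ?expR_ge0 ?fine_ge0//.
by rewrite -lee_fin fineK.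
Qed.

End moment_generating_function.

(** * Law of the initial weights of one output *)

Section initialization_law.
Context (R : realType) (d p n : nat).
Context (dO : measure_display) (Omega : measurableType dO) (P : probability Omega R).
Variables (W : 'I_d -> 'I_n -> 'I_p -> Omega -> R) (A : 'I_d -> 'I_n -> Omega -> bool).
Notation N01 := (normal_prob (0 : R) 1).
Hypothesis mW : forall i j k, measurable_fun setT (W i j k).
Hypothesis mA : forall i j, measurable (A i j @^-1` [set true]).
Hypothesis lawWA : forall (B : 'I_d -> 'I_n -> 'I_p -> set R) (s : 'I_d -> 'I_n -> bool),
  (forall i j k, measurable (B i j k)) ->
  P [set w | (forall i j k, B i j k (W i j k w)) /\ (forall i j, A i j w = s i j)]
  = ((\prod_(i < d) \prod_(j < n) \prod_(k < p)
        fine (N01 (B i j k))) / 2 ^+ (d * n))%:E.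

Lemma measurable_forall_fin (I : finType) (S : I -> set Omega) :
  (forall i, measurable (S i)) -> measurable [set w | forall i, S i w].
Proof.
move=> mS.
have -> : [set w | forall i, S i w] = \bigcap_(i in setT) S i.
  by apply/seteqP; split=> [w Sw i _|w Sw i]; exact: Sw.
by apply: fin_bigcap_measurable => //; exact: finite_finset.
Qed.

(** The event splits over the [2 ^ (d * n)] sign patterns, all of the same probability. *)
Lemma law_W (B : 'I_d -> 'I_n -> 'I_p -> set R) :
  (forall i j k, measurable (B i j k)) ->
  P [set w | forall i j k, B i j k (W i j k w)] =
  (\prod_(i < d) \prod_(j < n) \prod_(k < p) fine (N01 (B i j k)))%:E.
Proof.
move=> mB.
pose sig := {ffun 'I_d * 'I_n -> bool}.
pose S (s : sig) := [set w | (forall i j k, B i j k (W i j k w)) /\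
   (forall i j, A i j w = s (i, j))].
have -> : [set w | forall i j k, B i j k (W i j k w)] = \bigcup_(s in setT) S s.
  apply/seteqP; split=> [w Bw|w [s _ [Bw _]]]; last exact: Bw.
  by exists [ffun ij => A ij.1 ij.2 w] => //; split=> // i j; rewrite ffunE.
have mS s : measurable (S s).
  have -> : S s = [set w | forall i, forall j, forall k, B i j k (W i j k w)] `&`
      [set w | forall i, forall j, A i j w = s (i, j)] by [].
  apply: measurableI.
    apply: (measurable_forall_fin (S := fun i => [set w | forall j, forall k, B i j k (W i j k w)])) => i.
    apply: (measurable_forall_fin (S := fun j => [set w | forall k, B i j k (W i j k w)])) => j.
    apply: measurable_forall_fin => k.
    by rewrite -[X in measurable X]setTI; exact: mW.
  apply: (measurable_forall_fin (S := fun i => [set w | forall j, A i j w = s (i, j)])) => i.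
  apply: (measurable_forall_fin (S := fun j => [set w | A i j w = s (i, j)])) => j.
  case: (s (i, j)); first exact: mA.
  have -> : [set w | A i j w = false] = ~` (A i j @^-1` [set true]).
    by apply/seteqP; split=> w /=; case: (A i j w).
  exact: measurableC.
rewrite measure_fin_bigcup//; last 2 first.
- exact: finite_finset.
- move=> s t _ _ [w [[_ sw] [_ tw]]]; apply/ffunP => -[i j].
  by rewrite -sw tw.
have -> : [set: sig] = [set` enum sig].
  by apply/seteqP; split=> // s _; rewrite /= mem_enum.
rewrite -fsbig_seq ?enum_uniq//= big_enum /=.
rewrite (eq_bigr (fun=> ((\prod_(i < d) \prod_(j < n) \prod_(k < p)
        fine (N01 (B i j k))) / 2 ^+ (d * n))%:E)); last first.
  by move=> s _; rewrite -(lawWA (fun i j => s (i, j)) mB).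
rewrite sumEFin sumr_const card_ffun card_bool card_prod !card_ord.
by rewrite -[X in X%:E]mulr_natr natrX divfK// expf_neq0// pnatr_eq0.
Qed.

Definition Wrow i w : n.-tuple (p.-tuple R) :=
  [tuple [tuple W i j k w | k < p] | j < n].

Lemma measurable_Wrow i : measurable_fun setT (Wrow i).
Proof.
apply/measurable_fun_tnthP => j; apply/measurable_fun_tnthP => k.
rewrite (_ : _ \o _ = W i j k)//.
by apply/funext => w; rewrite /= !tnth_mktuple.
Qed.

Lemma law_Wrow i (S : set (n.-tuple (p.-tuple R))) : measurable S ->
  P (Wrow i @^-1` S) = iid_law (iid_law N01 p) n S.
Proof.
move=> mS.
(* [N01] lives on [measurableTypeR R], which has the same measurable sets as [R]
   but another display. *)
pose TV : measurableType _ := n.-tuple (p.-tuple (measurableTypeR R)).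
have mV : measurable_fun setT (Wrow i : Omega -> TV) by exact: measurable_Wrow.
pose HBm := isMeasurableFun.Build _ _ _ _ (Wrow i : Omega -> TV) mV.
pose V : {mfun Omega >-> TV} := HB.pack (Wrow i : Omega -> TV) HBm.
pose m : {measure set TV -> \bar R} :=
  distribution P V.
have := @iid_law_unique R _ _ (iid_law N01 p)
  (boxes (@measurable _ (measurableTypeR R)) (n := p)) n m.
apply => //.
- apply: measurable_boxes => //.
  apply/seteqP; split; first exact: sub_sigma_algebra.
  by apply: smallest_sub => //; exact: sigma_algebra_measurable.
- by exists (fun=> setT); split => //; apply/seteqP; split.
- by apply: setI_closed_boxes => X Y; exact: measurableI.
move=> B boxB.
have [B' B'P] := choice boxB.
(* The weights of the other outputs are left unconstrained and contribute factors 1 to the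
   product. *)
pose BB (i' : 'I_d) j k := if i' == i then B' j k else setT.
have E : (Wrow i @^-1` [set t | forall k, B k (tnth t k)]) =
    [set w | forall i' j k, BB i' j k (W i' j k w)].
  apply/seteqP; split=> w /=.
    move=> Bw i' j k; rewrite /BB; case: eqP => // ->.
    have := Bw j; rewrite (B'P j).2 /= => /(_ k).
    by rewrite !tnth_mktuple.
  move=> Bw j; rewrite (B'P j).2 /= => k.
  by have := Bw i j k; rewrite /BB eqxx !tnth_mktuple.
apply: (etrans (congr1 P E)).
rewrite law_W; last by move=> i' j k; rewrite /BB; case: ifP => // _; exact: (B'P j).1.
congr (_%:E).
rewrite (bigD1 i)//= [X in _ * X]big1 ?mulr1.
  apply: eq_bigr => j _; rewrite (B'P j).2 iid_law_box; last exact: (B'P j).1.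
  by apply: eq_bigr => k _; rewrite /BB eqxx.
move=> i' ii'; rewrite big1// => j _; rewrite big1// => k _.
by rewrite /BB (negbTE ii') probability_setT.
Qed.

End initialization_law.

(** The threshold [A] is chosen so that [expR (- A) <= delta]. Beyond it, with [v = |u| - A], one
    has [u ^+ 2 <= A ^+ 2 * (1 + v) ^+ 2 <= 4 * A ^+ 2 * expR v] and [expR v <= delta * expR |u|].
    The factor [delta] later absorbs the loss in Markov's inequality. *)
Lemma sqr_le_exp_tail (R : realType) (u delta : R) : 0 < delta < 1 ->
  u ^+ 2 <= (1 + ln delta^-1) ^+ 2 * (1 + 4 * delta * (expR u + expR (- u))).
Proof.
move=> /andP[d0 d1].
set A := 1 + ln delta^-1.
have A1 : 1 <= A by rewrite lerDl ln_ge0// invf_ge1// ltW.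
have eA : expR (- A) <= delta.
  rewrite /A opprD expRD lnV ?posrE// opprK lnK ?posrE//.
  by rewrite ler_piMl ?(ltW d0)// -[leRHS]expR0 ler_expR lerN10.
have cosh_ge : expR `|u| <= expR u + expR (- u).
  by case: (ger0P u) => _; [rewrite lerDl|rewrite lerDr]; exact: expR_ge0.
have A20 : 0 <= A ^+ 2 by exact: sqr_ge0.
have [uA|Au] := leP `|u| A.
  have : u ^+ 2 <= A ^+ 2.
    by rewrite -real_normK ?num_real// ler_pXn2r// nnegrE (le_trans _ A1).
  move=> /le_trans; apply; rewrite ler_peMr// lerDl.
  by rewrite !mulr_ge0 ?(ltW d0)// addr_ge0// expR_ge0.
pose v := `|u| - A.
have v0 : 0 < v by rewrite subr_gt0.
have uv : u ^+ 2 = (A + v) ^+ 2 by rewrite /v addrC subrK real_normK ?num_real.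
have ev : (1 + v / 2) ^+ 2 <= expR v.
  have -> : expR v = expR (v / 2) ^+ 2 by rewrite -expRM_natl; congr expR; field.
  by rewrite ler_pXn2r// ?nnegrE ?expR_ge0 ?expR_ge1Dx// addr_ge0// divr_ge0// ltW.
have ev2 : expR v <= (expR u + expR (- u)) * delta.
  rewrite /v expRD; apply: ler_pM; rewrite ?expR_ge0//.
rewrite uv; apply: (@le_trans _ _ (A ^+ 2 * (4 * expR v))).
  apply: (@le_trans _ _ (A ^+ 2 * (1 + v) ^+ 2)).
    have A0 : 0 <= A by exact: le_trans A1.
    rewrite -exprMn; apply: lerXn2r; rewrite ?nnegrE.
    - exact: addr_ge0 A0 (ltW v0).
    - by rewrite mulr_ge0// addr_ge0// ltW.
    - by rewrite mulrDr mulr1 lerD2l ler_peMl// ltW.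
  apply: ler_wpM2l => //; nra.
by apply: ler_wpM2l => //; lra.
Qed.

(** * Mean-square deviation of empirical means *)

Section concentration.
Context (R : realType) (d p n : nat).
Context (dO : measure_display) (Omega : measurableType dO) (P : probability Omega R).
Variables (W : 'I_d -> 'I_n -> 'I_p -> Omega -> R) (A : 'I_d -> 'I_n -> Omega -> bool).
Notation N01 := (normal_prob (0 : R) 1).
Hypothesis n0 : (0 < n)%N.
Hypothesis mW : forall i j k, measurable_fun setT (W i j k).
Hypothesis mA : forall i j, measurable (A i j @^-1` [set true]).
Hypothesis lawWA : forall (B : 'I_d -> 'I_n -> 'I_p -> set R) (s : 'I_d -> 'I_n -> bool),
  (forall i j k, measurable (B i j k)) ->
  P [set w | (forall i j k, B i j k (W i j k w)) /\ (forall i j, A i j w = s i j)]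
  = ((\prod_(i < d) \prod_(j < n) \prod_(k < p)
        fine (N01 (B i j k))) / 2 ^+ (d * n))%:E.

Definition Wvec i j w : p.-tuple R := [tuple W i j k w | k < p].

Lemma measurable_Wvec i j : measurable_fun setT (Wvec i j).
Proof.
apply/measurable_fun_tnthP => k.
rewrite (_ : _ \o _ = W i j k)//.
by apply/funext => w; rewrite /= !tnth_mktuple.
Qed.

(** The scale [s] is a parameter so that changing its sign negates the sum, and one moment bound
    covers both exponentials. *)
Definition dev_sum (zeta : p.-tuple R -> R) (s : R) i w : R :=
  \sum_(j < n) s * (zeta (Wvec i j w) - Rintegral (iid_law N01 p) setT zeta).

Lemma measurable_dev_sum (zeta : p.-tuple R -> R) s i : measurable_fun setT zeta ->
  measurable_fun setT (dev_sum zeta s i).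
Proof.
move=> mz; apply: measurable_sum => j; apply: measurable_funM => //.
apply: measurable_funB => //.
exact: measurableT_comp mz (measurable_Wvec i j).
Qed.

Lemma mgf_dev_sum_le2 (zeta : p.-tuple R -> R) (B s : R) i : 0 <= B ->
  measurable_fun setT zeta -> (forall y, `|zeta y| <= B) ->
  (4 * B * s) ^+ 2 <= n%:R^-1 ->
  (\int[P]_w (expR (dev_sum zeta s i w))%:E <= 2%:E)%E.
Proof.
move=> B0 mz zB sB.
pose f (t : n.-tuple (p.-tuple (measurableTypeR R))) :=
  expR (\sum_(j < n) s * (zeta (tnth t j) - Rintegral (iid_law N01 p) setT zeta)).
have mf : measurable_fun setT f.
  apply: measurableT_comp => //; apply: measurable_sum => j.
  apply: measurable_funM => //; apply: measurable_funB => //.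
  apply: measurableT_comp; first exact: mz.
  exact: measurable_tnth.
have := iid_law_mgf_le2 (iid_law N01 p) n0 B0 mz zB sB.
apply: le_trans.
pose TV : measurableType _ := n.-tuple (p.-tuple (measurableTypeR R)).
have mV : measurable_fun setT (Wrow W i : Omega -> TV) by exact: measurable_Wrow.
pose HBm := isMeasurableFun.Build _ _ _ _ (Wrow W i : Omega -> TV) mV.
pose V : {mfun Omega >-> TV} := HB.pack (Wrow W i : Omega -> TV) HBm.
have E1 : (\int[distribution P V]_t (f t)%:E =
    \int[iid_law (iid_law N01 p) n]_t (f t)%:E)%E.
  apply: eq_measure_integral => X mX _.
  exact: (law_Wrow mW mA lawWA).
have E2 : (\int[distribution P V]_t (f t)%:E =
    \int[P]_w (expR (dev_sum zeta s i w))%:E)%E.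
  rewrite ge0_integral_distribution; last 2 first.
  - exact/measurable_EFinP.
  - by move=> y; rewrite lee_fin expR_ge0.
  apply: eq_integral => w _.
  rewrite /f /dev_sum /=; congr (expR _)%:E; apply: eq_bigr => j _.
  by rewrite /Wrow tnth_mktuple.
by rewrite -E2 E1.
Qed.

(* [272 = 16 * 17]: the deviation is [4 B u / sqrt n] with [u] a [dev_sum], and
   [sum_z u_z^2 <= 17 #|J| (1 + ln delta^-1)^2] on [E]. *)
Lemma row_concentration (J : finType) (row : J -> 'I_d)
    (zeta : J -> p.-tuple R -> R) (B delta : R) :
  0 < delta < 1 -> (0 < #|J|)%N -> 0 < B ->
  (forall z, measurable_fun setT (zeta z)) -> (forall z y, `|zeta z y| <= B) ->
  exists E : set Omega, [/\ measurable E, ((1 - delta)%:E <= P E)%E &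
  forall w, E w ->
    \sum_z (n%:R^-1 * (\sum_(j < n) zeta z (Wvec (row z) j w)) -
             Rintegral (iid_law N01 p) setT (zeta z)) ^+ 2 <=
    272 * #|J|%:R * B ^+ 2 / n%:R * (1 + ln delta^-1) ^+ 2].
Proof.
move=> d01 J0 B0 mz zB; have /andP[d0 d1] := d01.
pose sn : R := Num.sqrt n%:R.
have nR : 0 < n%:R :> R by rewrite ltr0n.
have sn0 : 0 < sn by rewrite sqrtr_gt0.
have sn2 : sn ^+ 2 = n%:R by rewrite sqr_sqrtr// ltW.
(* The largest scale allowed by the moment bound: [(4 * B * s) ^+ 2] is exactly [1 / n]. *)
pose s := (4 * B * sn)^-1.
have sB : (4 * B * s) ^+ 2 <= n%:R^-1.
  have -> : 4 * B * s = sn^-1 by rewrite /s; field; rewrite !gt_eqF.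
  by rewrite exprVn sn2.
have sBN : (4 * B * - s) ^+ 2 <= n%:R^-1 by rewrite mulrN sqrrN.
pose u z w := dev_sum (zeta z) s (row z) w.
have uN z w : - u z w = dev_sum (zeta z) (- s) (row z) w.
  by rewrite /u /dev_sum -sumrN; apply: eq_bigr => j _; rewrite mulNr.
pose M w := \sum_z (expR (u z w) + expR (- u z w)).
have me z : measurable_fun setT (fun w => expR (u z w)).
  by apply: measurableT_comp => //; exact: measurable_dev_sum.
have meN z : measurable_fun setT (fun w => expR (- u z w)).
  under eq_fun do rewrite uN.
  by apply: measurableT_comp => //; exact: measurable_dev_sum.
have mM : measurable_fun setT M.
  by apply: measurable_sum => z; exact: measurable_funD.
have M0 w : 0 <= M w.
  by apply: sumr_ge0 => z _; rewrite addr_ge0 ?expR_ge0.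
have JR : 0 < #|J|%:R :> R by rewrite ltr0n.
(* Only linearity of expectation is used across [z]; deviations of one output at different rounds
   come from the same weights. *)
have intM : (\int[P]_w (M w)%:E <= (4 * #|J|%:R)%:E)%E.
  pose g z w : \bar R := (expR (u z w) + expR (- u z w))%:E.
  have mg z : measurable_fun setT (g z).
    by apply/measurable_EFinP; exact: measurable_funD.
  have g0 z w : setT w -> (0 <= g z w)%E.
    by rewrite lee_fin addr_ge0 ?expR_ge0.
  rewrite (eq_integral (fun w => (\sum_z g z w)%E)); last first.
    by move=> w _; rewrite sumEFin.
  rewrite (ge0_integral_sum P measurableT mg g0).
  have -> : (4 * #|J|%:R)%:E = (\sum_(z : J) 4%:E)%E :> \bar R.
    by rewrite sumEFin sumr_const mulr_natr.
  apply: lee_sum => z _.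
  rewrite (eq_integral (fun w => ((expR (u z w))%:E + (expR (- u z w))%:E)%E));
    last by move=> w _; rewrite -EFinD.
  rewrite ge0_integralD//; last 2 first.
  - by apply/measurable_EFinP; exact: me.
  - by apply/measurable_EFinP; exact: meN.
  have -> : 4%:E = (2%:E + 2%:E)%E :> \bar R by rewrite -EFinD; congr EFin; lra.
  apply: leeD; first exact: mgf_dev_sum_le2 (ltW B0) (mz z) (zB z) sB.
  under eq_integral do rewrite uN.
  exact: mgf_dev_sum_le2 (ltW B0) (mz z) (zB z) sBN.
(* The Markov threshold: the bound on the expectation of [M] divided by the allowed failure
   probability. *)
pose eps := 4 * #|J|%:R / delta.
have eps0 : 0 < eps by rewrite divr_gt0// mulr_gt0.
pose E := [set w | M w <= eps].
have mE : measurable E.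
  have -> : E = setT `&` M @^-1` `]-oo, eps].
    by rewrite setTI; apply/seteqP; split=> w; rewrite /E /= in_itv.
  exact: mM.
exists E; split => //.
  have mEC : measurable (~` E) by exact: measurableC.
  have H : (eps%:E * P (~` E) <= (eps * delta)%:E)%E.
    have -> : eps * delta = 4 * #|J|%:R by rewrite divfK// gt_eqF.
    apply: le_trans intM.
    rewrite -integral_cst//.
    apply: (@le_trans _ _ (\int[P]_(w in ~` E) (M w)%:E)%E).
      apply: ge0_le_integral => //.
      - by move=> w _; rewrite lee_fin ltW.
      - by apply/measurable_EFinP; exact: measurable_funTS.
      - by move=> w /= /negP; rewrite -ltNge lee_fin => /ltW.
    apply: ge0_subset_integral => //.
    - exact/measurable_EFinP.
    - by move=> w _; rewrite lee_fin.
  have PEfin : P (~` E) \is a fin_num by exact: fin_num_measure.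
  have H2 : (P (~` E) <= delta%:E)%E.
    move: H; rewrite -(fineK PEfin) -EFinM !lee_fin.
    by rewrite ler_pM2l.
  have -> : P E = (1 - P (~` E))%E.
    by rewrite -(probability_setC P mEC) setCK.
  by rewrite EFinB leeB.
move=> w Ew.
pose a := (1 + ln delta^-1 : R).
have devE z : n%:R^-1 * (\sum_(j < n) zeta z (Wvec (row z) j w)) -
    Rintegral (iid_law N01 p) setT (zeta z) = 4 * B / sn * u z w.
  rewrite /u /dev_sum -mulr_sumr sumrB sumr_const card_ord.
  set S := \sum_(_ < n) _; set I := Rintegral _ _ _.
  have -> : I *+ n = I * sn ^+ 2 by rewrite sn2 mulr_natr.
  rewrite /s -sn2; field.
  by rewrite !gt_eqF.
rewrite (eq_bigr (fun z => 16 * B ^+ 2 / n%:R * u z w ^+ 2)); last first.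
  by move=> z _; rewrite devE exprMn exprMn exprVn sn2; ring.
rewrite -mulr_sumr.
have Hu : \sum_z u z w ^+ 2 <= a ^+ 2 * (#|J|%:R + 4 * delta * M w).
  have -> : a ^+ 2 * (#|J|%:R + 4 * delta * M w) =
      \sum_z a ^+ 2 * (1 + 4 * delta * (expR (u z w) + expR (- u z w))).
    rewrite -mulr_sumr big_split /= sumr_const -mulr_sumr; congr (_ * (_ + _)).
  by apply: ler_sum => z _; exact: sqr_le_exp_tail.
have HM : 4 * delta * M w <= 16 * #|J|%:R.
  have : 4 * delta * M w <= 4 * delta * eps by rewrite ler_pM2l ?mulr_gt0.
  by have -> : 4 * delta * eps = 16 * #|J|%:R by rewrite /eps; field; rewrite gt_eqF.
have c0 : 0 <= 16 * B ^+ 2 / n%:R by apply: divr_ge0 => //; apply: mulr_ge0 => //; exact: sqr_ge0.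
apply: (@le_trans _ _ (16 * B ^+ 2 / n%:R * (a ^+ 2 * (17 * #|J|%:R)))).
  apply: ler_wpM2l => //; apply: (le_trans Hu); apply: ler_wpM2l; first exact: sqr_ge0.
  by lra.
by rewrite le_eqVlt; apply/orP; left; apply/eqP; rewrite /a; ring.
Qed.

End concentration.

(** * Random features *)

Section random_features.
Context (R : realType) (p : nat) (sigma : R -> R) (C D : R).
Notation N01 := (normal_prob (0 : R) 1).
Hypothesis C0 : 0 <= C.
Hypothesis D0 : 0 <= D.
Hypothesis lip_dsigma :
  forall z z' : R, `|derive1 sigma z - derive1 sigma z'| <= C * `|z - z'|.
Hypothesis dsigma_le : forall z : R, `|derive1 sigma z| <= C.

Lemma gauss_density_gt0 (v : p.-tuple R) : 0 < gauss_density v.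
Proof.
rewrite /gauss_density mulr_gt0 ?expR_gt0// invr_gt0 exprn_gt0// sqrtr_gt0.
by rewrite mulrn_wgt0// pi_gt0.
Qed.

Lemma measurable_dotx (x : 'I_p -> R) :
  measurable_fun setT (fun v : p.-tuple R => \sum_(k < p) tnth v k * x k).
Proof.
apply: measurable_sum => k; apply: measurable_funM => //.
exact: measurable_tnth.
Qed.

Lemma measurable_gauss_densityV :
  measurable_fun setT (fun v : p.-tuple R => (gauss_density v)^-1).
Proof.
under eq_fun do rewrite /gauss_density invfM invrK -expRN.
apply: measurable_funM => //; apply: measurableT_comp => //.
apply: measurableT_comp => //.
apply: measurable_funM => //; apply: measurableT_comp => //.
apply: measurable_sum => k; apply: measurable_funX.
exact: measurable_tnth.
Qed.

Lemma measurable_derive1_lip : measurable_fun setT (derive1 sigma).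
Proof.
apply: continuous_measurable_fun => z.
(* [C] may be 0 here, so the continuity modulus divides by [C + 1]. *)
have C1 : 0 < C + 1 by rewrite ltr_wpDl.
apply/cvgrPdist_lt => e e0; near=> y.
apply: le_lt_trans (lip_dsigma _ _) _.
apply: (@le_lt_trans _ _ ((C + 1) * `|z - y|)).
  by rewrite ler_wpM2r// lerDl.
rewrite mulrC -ltr_pdivlMr//.
near: y; apply/nbhs_ballP; exists (e / (C + 1)); first exact: divr_gt0.
by [].
Unshelve. all: by end_near. Qed.

(** The importance weight [c / p_0], whose Euclidean norm is what the RF-norm bounds. *)
Definition rf_weight (c : p.-tuple R -> 'I_p -> R) (v : p.-tuple R) k : R :=
  c v k / gauss_density v.

Definition rf_feature c (x : 'I_p -> R) (v : p.-tuple R) : R :=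
  (\sum_k rf_weight c v k * x k) * derive1 sigma (\sum_k tnth v k * x k).

Variable c : p.-tuple R -> 'I_p -> R.
Hypothesis c_in : rf_coef_in D c.

Lemma rf_weight_sqr_le v : \sum_k rf_weight c v k ^+ 2 <= D ^+ 2.
Proof.
have g0 := gauss_density_gt0 v.
have S0 : 0 <= \sum_k c v k ^+ 2 by apply: sumr_ge0 => k _; exact: sqr_ge0.
have -> : \sum_k rf_weight c v k ^+ 2 =
    (Num.sqrt (\sum_k c v k ^+ 2) / gauss_density v) ^+ 2.
  rewrite exprMn sqr_sqrtr// mulr_suml; apply: eq_bigr => k _.
  by rewrite exprMn.
apply: lerXn2r; rewrite ?nnegrE//; last exact: c_in.2.
by rewrite divr_ge0 ?sqrtr_ge0// ltW.
Qed.

Lemma rf_feature_le x v : \sum_k x k ^+ 2 = 1 -> `|rf_feature c x v| <= C * D.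
Proof.
move=> x1; rewrite normrM mulrC; apply: ler_pM => //.
rewrite -(@ler_pXn2r _ 2)// ?nnegrE// real_normK ?num_real//.
apply: (le_trans (sum_mul_sqr_le _ _)).
by rewrite x1 mulr1; exact: rf_weight_sqr_le.
Qed.

Lemma measurable_rf_feature x : measurable_fun setT (rf_feature c x).
Proof.
apply: measurable_funM.
  apply: measurable_sum => k; apply: measurable_funM => //.
  apply: measurable_funM; first exact: c_in.1.
  exact: measurable_gauss_densityV.
apply: measurableT_comp; first exact: measurable_derive1_lip.
exact: measurable_dotx.
Qed.

(** Writing [c] as density times [rf_weight] turns the Lebesgue integral into a Gaussian expectation
    of a function bounded by [C * D]. *)
Lemma rf_funE x : \sum_k x k ^+ 2 = 1 ->
  rf_fun sigma c x = Rintegral (iid_law N01 p) setT (rf_feature c x).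
Proof.
move=> x1.
rewrite -(integral_Rp_gauss (measurable_rf_feature x)
  (fun v => rf_feature_le v x1)).
rewrite /rf_fun; congr integral_Rp; apply/funext => v.
rewrite /rf_feature mulrA; congr (_ * _); rewrite mulr_sumr.
apply: eq_bigr => k _; rewrite /rf_weight.
by rewrite mulrA mulrCA divff ?mulr1// gt_eqF// gauss_density_gt0.
Qed.

Lemma rf_fun_le x : \sum_k x k ^+ 2 = 1 -> `|rf_fun sigma c x| <= C * D.
Proof.
move=> x1; rewrite rf_funE//; apply: normr_Rintegral_le.
  exact: measurable_rf_feature.
by move=> v; exact: rf_feature_le.
Qed.

End random_features.

(** * The oracle inequality *)

Lemma sqr_sum_nat_le (R : realType) (T : nat) (v : nat -> R) (b : R) : 0 <= b ->
  (\sum_(t < T) v t.+1 ^+ 2 <= b ^+ 2) ->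
  \sum_(1 <= t < T.+1) v t <= Num.sqrt T%:R * b.
Proof.
move=> b0 vb; rewrite big_add1 big_mkord.
rewrite (eq_bigr (fun t : 'I_T => 1 * v t.+1)); last by move=> t _; rewrite mul1r.
apply: sum_mul_le => //.
under eq_bigr do rewrite expr1n.
by rewrite sumr_const card_ord sqr_sqrtr.
Qed.

Section main.
Context (R : realType) (d p n : nat) (C L D delta : R) (T : nat).
Context (sigma : R -> R) (x : nat -> 'I_p -> R) (l : nat -> 'rV[R]_d -> R).
Context (dO : measure_display) (Omega : measurableType dO) (P : probability Omega R).
Variables (W : 'I_d -> 'I_n -> 'I_p -> Omega -> R) (A : 'I_d -> 'I_n -> Omega -> bool).
Notation N01 := (normal_prob (0 : R) 1).
Hypotheses (d0 : (0 < d)%N) (n0 : (0 < n)%N) (T0 : (0 < T)%N).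
Hypotheses (C0 : 0 < C) (L0 : 0 < L) (D1 : 1 < D) (delta01 : 0 < delta < 1).
Hypothesis dsigma : forall z : R, derivable sigma z 1.
Hypothesis lip_dsigma :
  forall z z' : R, `|derive1 sigma z - derive1 sigma z'| <= C * `|z - z'|.
Hypothesis dsigma_le : forall z : R, `|derive1 sigma z| <= C.
Hypothesis x1 : forall t, (1 <= t <= T)%N -> \sum_(k < p) x t k ^+ 2 = 1.
Hypothesis cvx : forall t, (1 <= t <= T)%N ->
  forall (u v : 'rV[R]_d) (lam : R), 0 <= lam <= 1 ->
  l t (lam *: u + (1 - lam) *: v) <= lam * l t u + (1 - lam) * l t v.
Hypothesis dl : forall t, (1 <= t <= T)%N -> forall u : 'rV[R]_d, differentiable (l t) u.
Hypothesis lip : forall t, (1 <= t <= T)%N -> forall u v : 'rV[R]_d,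
  `|l t u - l t v| <= L * eucl_norm (u - v).
Hypothesis mW : forall i j k, measurable_fun setT (W i j k).
Hypothesis mA : forall i j, measurable (A i j @^-1` [set true]).
Hypothesis lawWA : forall (B : 'I_d -> 'I_n -> 'I_p -> set R) (s : 'I_d -> 'I_n -> bool),
  (forall i j k, measurable (B i j k)) ->
  P [set w | (forall i j k, B i j k (W i j k w)) /\ (forall i j, A i j w = s i j)]
  = ((\prod_(i < d) \prod_(j < n) \prod_(k < p)
        fine (N01 (B i j k))) / 2 ^+ (d * n))%:E.

Let m := (n + n)%N.
Let Rad := D * Num.sqrt d%:R.
Let eta := fun t : nat => 2 * Rad / (C * L) * (Num.sqrt t%:R)^-1.
Let D0 : 0 < D. Proof. exact: lt_trans D1. Qed.
Let sd0 : 0 < Num.sqrt d%:R :> R. Proof. by rewrite sqrtr_gt0 ltr0n. Qed.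
Let Rad0 : 0 < Rad. Proof. exact: mulr_gt0. Qed.

Definition rf_loss (cs : 'I_d -> p.-tuple R -> 'I_p -> R) : R :=
  \sum_(1 <= t < T.+1) l t (\row_i rf_fun sigma (cs i) (x t)).

Lemma loss_lipschitz t u v : (1 <= t <= T)%N -> l t u <= l t v + L * eucl_norm (u - v).
Proof.
move=> tT; rewrite -lerBlDl.
exact: le_trans (ler_norm _) (lip tT u v).
Qed.

(** Here the event may depend on the comparator [cs], through the deviations of its empirical
    means. *)
Lemma oracle_inequality (cs : 'I_d -> p.-tuple R -> 'I_p -> R) :
  (forall i, rf_coef_in D (cs i)) ->
  exists E : set Omega, measurable E /\ ((1 - delta)%:E <= P E)%E /\
  forall w, E w ->
    \sum_(1 <= t < T.+1)
      l t (net sigma (fun i j => A i j w)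
             (traj sigma (fun i j => A i j w) (fun i j k => W i j k w)
                   Rad eta x l t.-1) (x t))
    <= rf_loss cs
     + 3 * (C * L) * Rad * Num.sqrt T%:R
     + 4 * Rad ^+ 2 * L * C * T%:R / Num.sqrt m%:R
     + 25 * (1 + ln delta^-1) * (T%:R * L * Num.sqrt d%:R * C * D ^+ 2 / Num.sqrt m%:R).
Proof.
move=> cs_in.
have xt1 (z : 'I_T * 'I_d) : \sum_k x z.1.+1 k ^+ 2 = 1 by apply: x1; rewrite /= ltn_ord.
(* All rounds and outputs are handled at once, with index set ['I_T * 'I_d] and bound [C * D] on the
   features. *)
have [||||E [mE PE HE]] := @row_concentration R d p n _ _ P W A n0 mW mA lawWA
  ('I_T * 'I_d)%type snd
  (fun z => rf_feature sigma (cs z.2) (x z.1.+1)) (C * D) delta delta01.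
- by rewrite card_prod !card_ord muln_gt0 T0.
- exact: mulr_gt0.
- by move=> z; exact: (measurable_rf_feature (ltW C0) lip_dsigma (cs_in z.2) (x z.1.+1)).
- by move=> z v; exact: (rf_feature_le (ltW D0) dsigma_le (cs_in z.2) v (xt1 z)).
exists E; split => //; split => // w Ew.
pose a i j := A i j w; pose W0 i j k := W i j k w.
pose rho i j := rf_weight (cs i) (Wvec W i j w).
have rho_le i j : \sum_k rho i j k ^+ 2 <= D ^+ 2.
  exact: (rf_weight_sqr_le (ltW D0) (cs_in i)).
pose U := comparator a W0 rho.
pose g t : 'rV[R]_d := \row_i rf_fun sigma (cs i) (x t).
pose e t : 'rV[R]_d := \row_i emp_mean sigma W0 rho (x t) i.
have reg := traj_regret n0 dsigma lip_dsigma dsigma_le a C0 L0 Rad0 (fun=> erefl)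
  x1 cvx dl lip (comparator_dist n0 a W0 rho_le).
apply: (le_trans reg); rewrite -/U -/m.
set r1 := 3 * _ * _ * _; set r2 := 4 * _ * _ * _ * _ / _.
have sm0 : 0 < Num.sqrt m%:R :> R by rewrite sqrtr_gt0 ltr0n addn_gt0 n0.
set a1 := (1 + ln delta^-1 : R).
have a1_ge1 : 1 <= a1.
  by have /andP[h0 h1] := delta01; rewrite lerDl ln_ge0// invf_ge1// ltW.
(* Two Lipschitz steps: from the network at [U] to the empirical mean [e t], then from [e t] to its
   expectation [g t]. *)
have netU t : (1 <= t <= T)%N -> l t (net sigma a U (x t)) <=
    l t (g t) + L * eucl_norm (e t - g t)
    + L * (Num.sqrt d%:R * (C * D ^+ 2 / Num.sqrt m%:R)).
  move=> tT; apply: (le_trans (loss_lipschitz _ (e t) tT)).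
  apply: lerD; first exact: loss_lipschitz.
  rewrite ler_pM2l//; apply: eucl_norm_le.
    by rewrite divr_ge0 ?(ltW sm0)// mulr_ge0 ?sqr_ge0// ltW.
  move=> i; rewrite !mxE -[X in _ <= X]/(C * D ^+ 2 / Num.sqrt (n + n)%:R).
  have := net_comparator n0 dsigma lip_dsigma dsigma_le a W0 rho_le i (x1 tT).
  by rewrite mxE.
have devs : \sum_(t < T) eucl_norm (e t.+1 - g t.+1) ^+ 2 <=
    (24 * a1 * Num.sqrt T%:R * Num.sqrt d%:R * (C * D) / Num.sqrt m%:R) ^+ 2.
  have -> : \sum_(t < T) eucl_norm (e t.+1 - g t.+1) ^+ 2 =
    \sum_(z : 'I_T * 'I_d) (n%:R^-1 * (\sum_(j < n) rf_feature sigma (cs z.2) (x z.1.+1)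
        (Wvec W z.2 j w)) -
      Rintegral (iid_law N01 p) setT (rf_feature sigma (cs z.2) (x z.1.+1))) ^+ 2.
    rewrite (eq_bigr (fun t : 'I_T => \sum_i (e t.+1 - g t.+1) 0 i ^+ 2)); last first.
      by move=> t _; rewrite sqr_eucl_norm.
    rewrite pair_big /=; apply: eq_bigr => z _; rewrite !mxE.
    rewrite (rf_funE (ltW C0) (ltW D0) lip_dsigma dsigma_le (cs_in _) (xt1 z)).
    congr (_ ^+ 2); congr (_ - _); congr (_ * _); apply: eq_bigr => j _.
    rewrite /rf_feature; congr (_ * derive1 sigma _).
    by apply: eq_bigr => k _; rewrite tnth_mktuple.
  apply: (le_trans (HE w Ew)); rewrite -/a1 card_prod !card_ord.
  have nR : 0 < n%:R :> R by rewrite ltr0n.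
  (* Since [m = 2 n], the constant 24 squares to [576 / m = 288 / n], which dominates the 272 of the
     concentration bound. *)
  have -> : (24 * a1 * Num.sqrt T%:R * Num.sqrt d%:R * (C * D) / Num.sqrt m%:R) ^+ 2
     = 288 * (T * d)%:R * (C * D) ^+ 2 / n%:R * a1 ^+ 2.
    rewrite !exprMn exprVn !sqr_sqrtr// natrM /m natrD; field.
    by rewrite !gt_eqF// addr_gt0.
  rewrite ler_wpM2r ?sqr_ge0// ler_wpM2r ?invr_ge0 ?(ltW nR)//.
  rewrite ler_wpM2r ?sqr_ge0// ler_wpM2r//; lra.
have sumdev : \sum_(1 <= t < T.+1) eucl_norm (e t - g t) <=
   24 * a1 * T%:R * Num.sqrt d%:R * (C * D) / Num.sqrt m%:R.
  have b0 : 0 <= 24 * a1 * Num.sqrt T%:R * Num.sqrt d%:R * (C * D) / Num.sqrt m%:R.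
    rewrite divr_ge0 ?(ltW sm0)// !mulr_ge0 ?sqrtr_ge0 ?(ltW C0) ?(ltW D0)//.
    exact: le_trans a1_ge1.
  have := sqr_sum_nat_le (v := fun t => eucl_norm (e t - g t)) b0 devs.
  have -> : 24 * a1 * T%:R * Num.sqrt d%:R * (C * D) / Num.sqrt m%:R =
    Num.sqrt T%:R * (24 * a1 * Num.sqrt T%:R * Num.sqrt d%:R * (C * D) / Num.sqrt m%:R).
    by rewrite -[in LHS](@sqr_sqrtr _ T%:R)//; ring.
  by [].
have sumU : \sum_(1 <= t < T.+1) l t (net sigma a U (x t)) <=
    rf_loss cs + L * (24 * a1 * T%:R * Num.sqrt d%:R * (C * D) / Num.sqrt m%:R)
    + T%:R * (L * (Num.sqrt d%:R * (C * D ^+ 2 / Num.sqrt m%:R))).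
  apply: (@le_trans _ _ (\sum_(1 <= t < T.+1) (l t (g t) + L * eucl_norm (e t - g t)
    + L * (Num.sqrt d%:R * (C * D ^+ 2 / Num.sqrt m%:R))))).
    rewrite big_nat [leRHS]big_nat; apply: ler_sum => t; rewrite ltnS.
    exact: netU.
  rewrite !big_split /= sumr_const_nat subn1 /= -/(rf_loss cs).
  rewrite -[X in _ + X]mulr_natl lerD2r lerD2l -mulr_sumr.
  by rewrite ler_pM2l.
set Q := T%:R * L * Num.sqrt d%:R * C / Num.sqrt m%:R.
have Q0 : 0 <= Q.
  by rewrite divr_ge0 ?(ltW sm0)// !mulr_ge0 ?sqrtr_ge0 ?(ltW C0) ?(ltW L0).
have E1 : L * (24 * a1 * T%:R * Num.sqrt d%:R * (C * D) / Num.sqrt m%:R) =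
  24 * a1 * D * Q by rewrite /Q; ring.
have E2 : T%:R * (L * (Num.sqrt d%:R * (C * D ^+ 2 / Num.sqrt m%:R))) = D ^+ 2 * Q.
  by rewrite /Q; ring.
have E3 : T%:R * L * Num.sqrt d%:R * C * D ^+ 2 / Num.sqrt m%:R = D ^+ 2 * Q.
  by rewrite /Q; ring.
rewrite E3; rewrite E1 E2 in sumU.
(* By [1 < D] and [1 <= a1], the deviation term [24 * a1 * D * Q] and the remainder [D ^+ 2 * Q] fit
   together under [25 * a1 * D ^+ 2 * Q]. *)
have DD : D <= D ^+ 2 by rewrite expr2 ler_peMr// ltW.
have a0 : 0 <= a1 by exact: le_trans a1_ge1.
have H1 : 24 * a1 * D * Q <= 24 * a1 * (D ^+ 2 * Q).
  rewrite -mulrA; apply: ler_wpM2l; first by rewrite mulr_ge0.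
  exact: ler_wpM2r.
have H2 : D ^+ 2 * Q <= a1 * (D ^+ 2 * Q).
  by rewrite ler_peMl// mulr_ge0// sqr_ge0.
move: sumU H1 H2; set S := \sum_(1 <= t < _) _; lra.
Qed.

(* The infimum over the comparator class need not be attained. *)
Lemma near_minimizer (eps : R) : 0 < eps ->
  exists2 cs : 'I_d -> p.-tuple R -> 'I_p -> R, (forall i, rf_coef_in D (cs i)) &
  forall cs', (forall i, rf_coef_in D (cs' i)) -> rf_loss cs <= rf_loss cs' + eps.
Proof.
move=> eps0.
pose S : set R := [set y | exists2 cs, (forall i, rf_coef_in D (cs i)) & y = rf_loss cs].
have S_inf : has_inf S.
  split.
    exists (rf_loss (fun _ _ _ => 0)), (fun _ _ _ => 0) => // i; split => // v.
    by rewrite big1 ?sqrtr0 ?mul0r ?(ltW D0)// => k _; rewrite expr0n.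
  (* Outputs of the class are bounded by [C * D], so the Lipschitz property at the output 0 bounds
     the losses from below. *)
  exists (\sum_(1 <= t < T.+1) (l t 0 - L * (Num.sqrt d%:R * (C * D)))).
  move=> _ [cs cs_in ->]; rewrite /rf_loss.
  rewrite big_nat [leRHS]big_nat; apply: ler_sum => t; rewrite ltnS => tT.
  rewrite lerBlDr; apply: le_trans (loss_lipschitz 0 (\row_i rf_fun sigma (cs i) (x t)) tT) _.
  rewrite lerD2l ler_pM2l//; apply: eucl_norm_le.
    by rewrite mulr_ge0 ?(ltW C0) ?(ltW D0).
  move=> i; rewrite !mxE sub0r normrN.
  exact: (rf_fun_le (ltW C0) (ltW D0) lip_dsigma dsigma_le (cs_in i) (x1 tT)).
have [_ [cs cs_in ->] csP] := inf_adherent eps0 S_inf.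
exists cs => // cs' cs'_in.
apply: (le_trans (ltW csP)); rewrite lerD2r.
by apply: ge_inf; [exact: S_inf.2|exists cs'].
Qed.

End main.

Unset Implicit Arguments. Set Strict Implicit. Set Printing Implicit Defensive.

Theorem mainTheorem7 (R : realType) :
  exists (K : R) (e : nat), 0 <= K /\
  forall (d p n : nat) (C L D delta : R) (T : nat)
    (sigma : R -> R) (x : nat -> 'I_p -> R) (l : nat -> 'rV[R]_d -> R)
    (dO : measure_display) (Omega : measurableType dO) (P : probability Omega R)
    (W : 'I_d -> 'I_n -> 'I_p -> Omega -> R) (A : 'I_d -> 'I_n -> Omega -> bool),
  (0 < d)%N -> (0 < p)%N -> (0 < n)%N ->
  0 < C -> 0 < L -> 1 < D -> 0 < delta < 1 ->
  (* activation *)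
  (forall z : R, derivable sigma z 1) ->
  (forall z z' : R, `|derive1 sigma z - derive1 sigma z'| <= C * `|z - z'|) ->
  (forall z : R, `|derive1 sigma z| <= C) ->
  (* data on the unit sphere *)
  (forall t, (1 <= t <= T)%N -> \sum_(k < p) x t k ^+ 2 = 1) ->
  (* losses: convex, differentiable, L-Lipschitz *)
  (forall t, (1 <= t <= T)%N -> forall (u v : 'rV[R]_d) (lam : R), 0 <= lam <= 1 ->
      l t (lam *: u + (1 - lam) *: v) <= lam * l t u + (1 - lam) * l t v) ->
  (forall t, (1 <= t <= T)%N -> forall u : 'rV[R]_d, differentiable (l t) u) ->
  (forall t, (1 <= t <= T)%N -> forall u v : 'rV[R]_d,
      `|l t u - l t v| <= L * eucl_norm (u - v)) ->
  (* random initialization: W i j ~ N(0, I_p), a_{i,j} uniform signs, all independent *)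
  (forall i j k, measurable_fun setT (W i j k)) ->
  (forall i j, measurable (A i j @^-1` [set true])) ->
  (forall (B : 'I_d -> 'I_n -> 'I_p -> set R) (s : 'I_d -> 'I_n -> bool),
      (forall i j k, measurable (B i j k)) ->
      P [set w | (forall i j k, B i j k (W i j k w)) /\ (forall i j, A i j w = s i j)]
      = ((\prod_(i < d) \prod_(j < n) \prod_(k < p)
            fine (normal_prob 0 1 (B i j k))) / 2 ^+ (d * n))%:E) ->
  let m := (n + n)%N in
  let Rad := D * Num.sqrt d%:R in
  let eta := fun t : nat => 2 * Rad / (C * L) * (Num.sqrt t%:R)^-1 in
  let err :=
    K * (1 + ln (d%:R / delta)) ^+ e *
      (L * Num.sqrt (d * p)%:R * C * D ^+ 2 * T%:R / Num.sqrt m%:R)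
    + K * (C * L * D * Num.sqrt (d * T)%:R
           + C * L * D ^+ 2 * d%:R * T%:R / Num.sqrt m%:R) in
  exists E : set Omega, measurable E /\ ((1 - delta)%:E <= P E)%E /\
  forall w, E w ->
    forall cs : 'I_d -> p.-tuple R -> 'I_p -> R,
      (forall i, rf_coef_in D (cs i)) ->
      \sum_(1 <= t < T.+1)
          l t (net sigma (fun i j => A i j w)
                 (traj sigma (fun i j => A i j w) (fun i j k => W i j k w)
                       Rad eta x l t.-1) (x t))
      <= \sum_(1 <= t < T.+1) l t (\row_i rf_fun sigma (cs i) (x t)) + err.
Proof.
(* 25 is the constant of the logarithmic term, whose logarithm has exponent 1; the two remaining
   terms only need the constant 4. *)
exists 25, 1%N; split=> //.
move=> d p n C L D delta T sigma x l dO Omega P W A d0 p0 n0 C0 L0 D1 delta01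
  dsigma lip_dsigma dsigma_le x1 cvx dl lip mW mA lawWA m Rad eta err.
have D0 : 0 < D by exact: lt_trans D1.
have /andP[delta0 delta1] := delta01.
have sm0 : 0 < Num.sqrt m%:R :> R by rewrite sqrtr_gt0 ltr0n addn_gt0 n0.
have lnd : ln delta^-1 <= ln (d%:R / delta) :> R.
  rewrite ler_ln ?posrE ?invr_gt0 ?divr_gt0 ?ltr0n//.
  by rewrite ler_peMl ?invr_ge0 ?(ltW delta0)// ler1n.
have ln0 : 0 <= ln delta^-1 :> R by rewrite ln_ge0// invf_ge1// ltW.
(* For [T = 0] both sums and [err] vanish; otherwise the tolerance [slack] below is positive. *)
have [T_eq0|T0] := posnP T.
  exists setT; split; first exact: measurableT.
  split; first by rewrite probability_setT lee_fin gerBl ltW.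
  move=> w _ cs _; rewrite {1 2}T_eq0 !big_nil add0r /err.
  by rewrite T_eq0 muln0 sqrtr0 !(mulr0, mul0r, addr0).
(* The near-minimizer is allowed an excess equal to one third of the descent regret, which raises
   that term from [3 * slack] to [4 * slack]. *)
pose slack := C * L * D * Num.sqrt (d * T)%:R.
have slack0 : 0 < slack.
  by rewrite !mulr_gt0// sqrtr_gt0 ltr0n muln_gt0 d0.
have [cs cs_in csP] := near_minimizer C0 L0 D1 lip_dsigma dsigma_le x1 lip slack0.
(* The event belongs to the near-minimizer [cs], chosen before any [cs']; hence the same event
   serves every comparator. *)
have [E [mE [PE HE]]] := oracle_inequality d0 n0 T0 C0 L0 D1 delta01
  dsigma lip_dsigma dsigma_le x1 cvx dl lip mW mA lawWA cs_in.
exists E; split=> //; split=> // w Ew cs' cs'_in.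
apply: (le_trans (HE w Ew)).
have := csP cs' cs'_in; rewrite /rf_loss.
set S := \sum_(1 <= t < T.+1) _; set S' := \sum_(1 <= t < T.+1) _ => SS'.
have sdT : Num.sqrt (d * T)%:R = Num.sqrt d%:R * Num.sqrt T%:R :> R.
  by rewrite natrM sqrtrM.
have r1 : 3 * (C * L) * (D * Num.sqrt d%:R) * Num.sqrt T%:R = 3 * slack.
  by rewrite /slack sdT; ring.
pose q := C * L * D ^+ 2 * d%:R * T%:R / Num.sqrt m%:R.
have r2 : 4 * (D * Num.sqrt d%:R) ^+ 2 * L * C * T%:R / Num.sqrt m%:R = 4 * q.
  by rewrite exprMn sqr_sqrtr// /q; ring.
have q0 : 0 <= q.
  by rewrite divr_ge0 ?(ltW sm0)// !mulr_ge0 ?(ltW C0) ?(ltW L0) ?(ltW D0).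
have sdp : Num.sqrt d%:R <= Num.sqrt (d * p)%:R :> R.
  by rewrite ler_wsqrtr// ler_nat leq_pmulr.
pose B := T%:R * L * C * D ^+ 2 / Num.sqrt m%:R.
have B0 : 0 <= B.
  by rewrite divr_ge0 ?(ltW sm0)// !mulr_ge0 ?(ltW C0) ?(ltW L0) ?(ltW D0).
(* The bound in [sqrt d] and [ln (1 / delta)] is relaxed to [sqrt (d * p)] and [ln (d / delta)],
   using [p >= 1] and [d >= 1]. *)
have r3 : 25 * (1 + ln delta^-1) *
    (T%:R * L * Num.sqrt d%:R * C * D ^+ 2 / Num.sqrt m%:R) <=
    25 * (1 + ln (d%:R / delta)) ^+ 1 *
      (L * Num.sqrt (d * p)%:R * C * D ^+ 2 * T%:R / Num.sqrt m%:R).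
  have -> : T%:R * L * Num.sqrt d%:R * C * D ^+ 2 / Num.sqrt m%:R =
    Num.sqrt d%:R * B by rewrite /B; ring.
  have -> : L * Num.sqrt (d * p)%:R * C * D ^+ 2 * T%:R / Num.sqrt m%:R =
    Num.sqrt (d * p)%:R * B by rewrite /B; ring.
  rewrite expr1; apply: ler_pM.
  - by rewrite mulr_ge0// addr_ge0.
  - by rewrite mulr_ge0 ?sqrtr_ge0.
  - by rewrite ler_pM2l// lerD2l.
  - exact: ler_wpM2r.
rewrite r1 r2 /err -/m -/slack -/q; lra.
Qed.
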